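(* Let $W$ be a group and let $(W,S)$ and $(W,S')$ be Coxeter systems with two-dimensional Davis-Vinberg complexes, i.e. $\dim\Sigma(W,S)=\dim\Sigma(W,S')=2$. Then there exists a subset $S''\subset W$ such that $(W,S'')$ is a Coxeter system which is isomorphic to $(W,S)$ and the set of reflections in $(W,S'')$ coincides with the set of reflections in $(W,S')$.
   Context: A Coxeter system $(W,S)$ consists of a group $W$ and a finite generating set $S\subset W$ such that $W$ has the presentation $\langle S \mid (st)^{m(s,t)}=1 \text{ for } s,t\in S\rangle$, where $m:S\times S\to\mathbb{N}\cup\{\infty\}$ satisfies $m(s,t)=m(t,s)$, $m(s,s)=1$, and $m(s,t)\ge 2$ for $s\ne t$ (there is no relation when $m(s,t)=\infty$). Then $m(s,t)$ is the order of $st$ in $W$. Two Coxeter systems $(W_1,S_1)$ and $(W_2,S_2)$, with order functions $m_1,m_2$, are isomorphic if there is a bijection $\psi:S_1\to S_2$ with $m_1(s,t)=m_2(\psi(s),\psi(t))$ for all $s,t\in S_1$. A reflection in $(W,S)$ is a conjugate in $W$ of an element of $S$. For $T\subset S$, $W_T$ denotes the subgroup of $W$ generated by $T$; $T$ is spherical if $W_T$ is finite. The Davis-Vinberg complex $\Sigma(W,S)$ is the geometric realization of the set of all left cosets $wW_T$ ($w\in W$, $T\subset S$ spherical) partially ordered by inclusion; its dimension is $\dim\Sigma(W,S)=\max\{|T| : T \text{ is a spherical subset of } S\}$. *)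

(* Defs.v *)
From mathcomp Require Import all_boot finmap.
From mathcomp Require Import boolp classical_sets functions cardinality.

Set Implicit Arguments.
Unset Strict Implicit.
Unset Printing Implicit Defensive.

Local Open Scope group_scope.
Local Open Scope fset_scope.
Local Open Scope classical_set_scope.
Local Open Scope card_scope.

Section Presentation.
Variable A : Type.

(* The letter (a, false) stands for the generator a, (a, true) for its formal
   inverse. *)
Definition word := seq (A * bool).

(* Equality in the group <A | r = 1 for r in R>, i.e. in the quotient of the
   free group on A by the normal closure of R. *)
Inductive pres_eq (R : set word) : word -> word -> Prop :=
| pres_refl u : pres_eq R u u
| pres_sym u v : pres_eq R u v -> pres_eq R v u
| pres_trans u v w : pres_eq R u v -> pres_eq R v w -> pres_eq R u w
| pres_cat u u' v v' :
    pres_eq R u u' -> pres_eq R v v' -> pres_eq R (u ++ v) (u' ++ v')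
| pres_cancel a b : pres_eq R [:: (a, b); (a, ~~ b)] [::]
| pres_rel r : R r -> pres_eq R r [::].

Definition eval_word (W : groupType) (f : A -> W) (u : word) : W :=
  \prod_(l <- u) (if l.2 then (f l.1)^-1 else f l.1).

(* Evaluation induces an isomorphism from <A | R> onto W. *)
Definition presents (W : groupType) (f : A -> W) (R : set word) : Prop :=
  (forall w : W, exists u, eval_word f u = w) /\
  (forall u v, eval_word f u = eval_word f v <-> pres_eq R u v).

End Presentation.

(* None encodes the value infinity. *)
Definition coxeter_relators (A : Type) (m : A -> A -> option nat) :
    set (word A) :=
  [set r | exists s t n, m s t = Some n /\
           r = flatten (nseq n [:: (s, false); (t, false)])].

Record coxeterSystem (W : groupType) := CoxeterSystem {
  cox_gens : {fset W};
  cox_ord : cox_gens -> cox_gens -> option nat;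
  cox_ordC : forall s t, cox_ord s t = cox_ord t s;
  cox_ord_diag : forall s, cox_ord s s = Some 1%N;
  cox_ord_ge2 : forall s t n, s != t -> cox_ord s t = Some n -> (2 <= n)%N;
  cox_presents :
    presents (fun s : cox_gens => val s) (coxeter_relators cox_ord)
}.

Definition cox_isomorphic (W1 W2 : groupType)
    (C1 : coxeterSystem W1) (C2 : coxeterSystem W2) : Prop :=
  exists2 psi : cox_gens C1 -> cox_gens C2, bijective psi &
    forall s t, cox_ord s t = cox_ord (psi s) (psi t).

Definition is_subgroup (W : groupType) (H : set W) : Prop :=
  [/\ H 1, forall x y, H x -> H y -> H (x * y) & forall x, H x -> H x^-1].

Definition generated (W : groupType) (T : set W) : set W :=
  smallest (@is_subgroup W) T.

Section CoxeterSystemTheory.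
Variables (W : groupType) (C : coxeterSystem W).

Definition reflections : set W :=
  [set r | exists s w : W, s \in cox_gens C /\ r = s ^ w].

Definition spherical (T : set W) : Prop :=
  T `<=` [set` cox_gens C] /\ finite_set (generated T).

Definition spherical_cosets : set (set W) :=
  [set X | exists (w : W) (T : set W),
     spherical T /\ X = [set w * x | x in generated T]].

(* The n-simplices of the geometric realization of spherical_cosets ordered by
   inclusion: its chains with n + 1 elements. *)
Definition davis_simplex (n : nat) (K : set (set W)) : Prop :=
  [/\ K `<=` spherical_cosets,
      total_on K (fun X Y => X `<=` Y) & K #= `I_n.+1].

Definition davis_dim_eq (n : nat) : Prop :=
  (exists K, davis_simplex n K) /\
  (forall k K, davis_simplex k K -> (k <= n)%N).

End CoxeterSystemTheory.

(* Main.v *)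
Require Import Defs.
From Stdlib Require Import Reals Lra.
From HB Require Import structures.
From mathcomp Require Import all_boot finmap zify.
From mathcomp Require Import boolp classical_sets functions cardinality.

(* Write R and R' for the reflections of (W,S) and (W,S'). Every finite
   subgroup of W is conjugate into a spherical W_T; here |T| <= 2, so this is a
   dihedral group, whose elements of odd length are reflections.
     If s in S is not
   in R', then s is conjugate to the central rotation of some W_{s',t'}, and a
   finite m(s,u) with u <> s gives a finite group <s,u>, again inside a dihedral
   group of S' in which s is central: hence m(s,u) = 2, and u and su lie in R'.
   Such a u exists, and it is unique: the elements of R' occurring in such a
   decomposition of s fix every point fixed by s, so two candidates u1, u2 would
   generate with s a finite group, against dim = 2. Replacing every such s by su
   therefore extends to an involutive automorphism of W, and S'' is its image of
   S. Then S'' is contained in R', so the length parities of S'' and S' agree,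
   and the same dihedral argument applied to S'' puts S' into R''.

   The statement on finite subgroups comes from the Tits cone of the
   contragredient geometric representation: the sum of the orbit of an interior
   point under a finite subgroup is a fixed point in the cone,
     and the stabilizer
   of that point is finite and conjugate to some W_T. *)

Set Implicit Arguments.
Unset Strict Implicit.
Unset Printing Implicit Defensive.

Delimit Scope R_scope with Re.
Local Open Scope group_scope.
Local Open Scope fset_scope.
Local Open Scope classical_set_scope.
Local Open Scope card_scope.

(** * Words and homomorphisms *)

Section Presentations.

Lemma pres_eq_map (A B : Type) (h : A -> B) (R : set (word A))
    (R' : set (word B)) u v :
  (forall r, R r -> R' [seq (h l.1, l.2) | l <- r]) -> pres_eq R u v ->
  pres_eq R' [seq (h l.1, l.2) | l <- u] [seq (h l.1, l.2) | l <- v].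
Proof.
move=> hR; elim=> {u v}.
- by move=> u; exact: pres_refl.
- by move=> u v _; exact: pres_sym.
- by move=> u v w _ uv _ vw; exact: pres_trans uv vw.
- by move=> u u' v v' _ uu' _ vv'; rewrite !map_cat; exact: pres_cat.
- by move=> a b; exact: pres_cancel.
- by move=> r /hR; exact: pres_rel.
Qed.

(** Each [F s] is an involution, so a letter and its formal inverse may act alike and the fold
    ignores signs. *)
Lemma pres_eq_act (A X : Type) (m : A -> A -> option nat) (F : A -> X -> X) :
  (forall s, F s \o F s = id) ->
  (forall s t n, m s t = Some n -> iter n (F s \o F t) =1 id) ->
  forall u v, pres_eq (coxeter_relators m) u v ->
  forall x, foldr (fun l => F l.1) x u = foldr (fun l => F l.1) x v.
Proof.
move=> FK Fm u v; elim=> {u v}.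
- by [].
- by move=> u v _ uv x.
- by move=> u v w _ uv _ vw x; rewrite uv.
- by move=> u u' v v' _ uu' _ vv' x; rewrite !foldr_cat vv' uu'.
- by move=> a b x; rewrite /= -[LHS]/((F a \o F a) x) FK.
- move=> _ [s [t [n [mst ->]]]] x /=; rewrite -[RHS](Fm _ _ _ mst).
  by elim: (n) => //= k ->.
Qed.

End Presentations.

Lemma morphism1 (G H : groupType) (f : G -> H) :
  {morph f : x y / x * y} -> f 1 = 1.
Proof. by move=> fM; apply: (@mulgI _ (f 1)); rewrite -fM !mulg1. Qed.

Section Coxeter.
Variables (W : groupType) (C : coxeterSystem W).

Notation I := (cox_gens C).

Definition ev (u : seq I) : W := \prod_(s <- u) val s.

Lemma ev_nil : ev [::] = 1. Proof. exact: big_nil. Qed.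

Lemma ev_cons s u : ev (s :: u) = val s * ev u. Proof. exact: big_cons. Qed.

Lemma ev1 s : ev [:: s] = val s. Proof. exact: big_seq1. Qed.

Lemma ev_cat u v : ev (u ++ v) = ev u * ev v. Proof. exact: big_cat. Qed.

Lemma gen_rel (s t : I) n : cox_ord s t = Some n -> (val s * val t) ^+ n = 1.
Proof.
move=> mst; have [_ presP] := cox_presents C.
pose r := flatten (nseq n [:: (s, false); (t, false)]).
have: eval_word (fun s : I => val s) r = 1.
  rewrite (presP r [::]).2 ?[LHS]big_nil //.
  by apply: pres_rel; exists s, t, n.
move=> <-; rewrite /r.
elim: (n) => [|k IHk]; first by rewrite expg0 [RHS]big_nil.
by rewrite expgS IHk /= /eval_word !big_cons mulgA.
Qed.

Lemma gen_sqr (s : I) : val s * val s = 1.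
Proof. by rewrite -(gen_rel (cox_ord_diag s)) expg1. Qed.

Lemma genV (s : I) : (val s)^-1 = val s.
Proof. exact: mulg1_eq (gen_sqr s). Qed.

Lemma genKl (s : I) : involutive (mul (val s)).
Proof. by move=> x; rewrite mulgA gen_sqr mul1g. Qed.

Lemma eval_wordE (u : word I) :
  eval_word (fun s : I => val s) u = ev [seq l.1 | l <- u].
Proof.
rewrite /eval_word /ev big_map; apply: eq_bigr => -[s []] //= _.
exact: genV.
Qed.

Lemma ev_surj w : exists u, ev u = w.
Proof.
have [/(_ w)[u <-] _] := cox_presents C.
by exists [seq l.1 | l <- u]; rewrite eval_wordE.
Qed.

Lemma gen_ind (P : W -> Prop) :
  P 1 -> (forall (s : I) w, P w -> P (val s * w)) -> forall w, P w.
Proof.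
move=> P1 PM w; have [u <-] := ev_surj w.
by elim: u => [|s u IHu]; rewrite ?ev_nil // ev_cons; exact: PM.
Qed.

(** The universal property of the presentation, phrased for actions on a bare type so that it yields
    group morphisms, parity maps and the linear representation alike. Involutivity of [F s] comes
    from the diagonal relator of exponent 1. *)
Lemma lift_action (X : Type) (F : I -> X -> X) :
  (forall s t n, cox_ord s t = Some n -> iter n (F s \o F t) =1 id) ->
  exists a : W -> X -> X, [/\ forall x, a 1 x = x,
    forall g h x, a (g * h) x = a g (a h x) & forall s, a (val s) = F s].
Proof.
move=> Fm.
have FK s : F s \o F s = id.
  by apply/funext => x; have := Fm _ _ _ (cox_ord_diag s) x.
have evE u v : ev u = ev v -> forall x, foldr F x u = foldr F x v.
  move=> uv x; pose pos := map (fun s : I => (s, false)).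
  have posE w : [seq l.1 | l <- pos w] = w by rewrite -map_comp map_id.
  have foldE w : foldr F x w = foldr (fun l => F l.1) x (pos w).
    by elim: w => //= s w ->.
  rewrite !foldE; apply: (pres_eq_act FK Fm).
  by have [_ <-] := cox_presents C; rewrite !eval_wordE !posE.
pose wd w := projT1 (cid (ev_surj w)).
have wdE w : ev (wd w) = w by rewrite /wd; case: cid.
exists (fun w x => foldr F x (wd w)); split.
- by move=> x; rewrite (evE _ [::]) // wdE ev_nil.
- by move=> g h x; rewrite (evE _ (wd g ++ wd h)) ?foldr_cat // ev_cat !wdE.
- by move=> s; apply/funext => x; rewrite (evE _ [:: s]) // wdE ev1.
Qed.

(** [G] is acted on by left translations; the morphism is the orbit map of [1]. *)
Lemma lift_morphism (G : groupType) (f : I -> G) :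
  (forall s t n, cox_ord s t = Some n -> (f s * f t) ^+ n = 1) ->
  exists phi : W -> G,
    {morph phi : x y / x * y} /\ forall s, phi (val s) = f s.
Proof.
move=> fm; have [|a [a1 aM aF]] := @lift_action G (fun s => mul (f s)).
  move=> s t n /fm fst x; rewrite -[RHS]mul1g -fst -iter_mulg.
  by apply: eq_iter => y /=; rewrite mulgA.
exists (a^~ 1); split=> [x y|s]; last by rewrite aF mulg1.
elim/gen_ind: x y => [|s w IHw] y; first by rewrite !mul1g a1 mul1g.
by rewrite -mulgA aM IHw (aM _ w) aF mulgA.
Qed.

Lemma morph_gen_eq (G : groupType) (phi psi : W -> G) :
  {morph phi : x y / x * y} -> {morph psi : x y / x * y} ->
  (forall s : I, phi (val s) = psi (val s)) -> phi =1 psi.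
Proof.
move=> phiM psiM e; elim/gen_ind => [|s w IHw]; last by rewrite phiM psiM e IHw.
by rewrite !morphism1.
Qed.

End Coxeter.

(** * Word length *)

Section Length.
Variables (W : groupType) (C : coxeterSystem W).

Notation I := (cox_gens C).

(** A relator of even exponent imposes nothing modulo 2. *)
Lemma lift_bool (f : I -> bool) :
  (forall s t n, cox_ord s t = Some n -> odd n -> f s = f t) ->
  exists p : W -> bool,
    {morph p : x y / x * y >-> x (+) y} /\ forall s : I, p (val s) = f s.
Proof.
move=> fm; have [|a [a1 aM aF]] := @lift_action W C bool (fun s => addb (f s)).
  move=> s t n /fm fst b.
  have -> : iter n (addb (f s) \o addb (f t)) b =
            (odd n && (f s (+) f t)) (+) b.
    elim: {fst} n => //= n ->.
    by case: (odd n) (f s) (f t) b => [] [] [] [].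
  by case: (odd n) fst => [->|_] //; rewrite addbb.
exists (a^~ false); split=> [x y|s]; last by rewrite aF addbF.
elim/(@gen_ind W C): x y => [|s w IHw] y; first by rewrite mul1g a1.
by rewrite -mulgA aM IHw (aM _ w) aF addbA.
Qed.

Lemma len_subproof w :
  exists n, `[< exists2 u : seq I, size u = n & ev u = w >].
Proof. by have [u <-] := ev_surj C w; exists (size u); apply/asboolP;
  exists u. Qed.

Definition len w := ex_minn (len_subproof w).

Lemma len_word w : exists2 u : seq I, size u = len w & ev u = w.
Proof. by rewrite /len; case: ex_minnP => n /asboolP. Qed.

Lemma len_ev (u : seq I) : (len (ev u) <= size u)%N.
Proof. by rewrite /len; case: ex_minnP => n _; apply; apply/asboolP; exists u.
  Qed.

Lemma len1 : len 1 = 0%N.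
Proof. by apply/eqP; rewrite -leqn0 -(ev_nil C) len_ev. Qed.

Lemma len_eq0 w : len w = 0%N -> w = 1.
Proof. by have [[|s u] //= <- <-] := len_word w; rewrite ?ev_nil. Qed.

Lemma lenM g h : (len (g * h) <= len g + len h)%N.
Proof.
have [u <- <-] := len_word g; have [v <- <-] := len_word h.
by rewrite -ev_cat -size_cat len_ev.
Qed.

Lemma lenV g : len g^-1 = len g.
Proof.
suff le h : (len h^-1 <= len h)%N.
  by apply/eqP; rewrite eqn_leq le -{1}(invgK g) le.
have [u <- <-] := len_word h; rewrite -size_rev.
suff -> : (ev u)^-1 = ev (rev u) by exact: len_ev.
elim: u => [|s u IHu]; first by rewrite !ev_nil invg1.
by rewrite rev_cons -cats1 ev_cat ev1 -IHu ev_cons invgM genV.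
Qed.

Lemma len_gen (s : I) : (len (val s) <= 1)%N.
Proof. by rewrite -ev1 len_ev. Qed.

Definition par w := odd (len w).

Lemma par_morph : {morph par : x y / x * y >-> x (+) y}.
Proof.
have [//|p [pM p1]] := @lift_bool xpredT.
have p_len w : par w = p w.
  rewrite /par; have [u <- <-] := len_word w; elim: u => [|s u IHu].
    by rewrite ev_nil; apply/esym; have := pM 1 1; rewrite mulg1; case: (p 1).
  by rewrite ev_cons pM p1 -IHu.
by move=> x y; rewrite !p_len pM.
Qed.

Lemma par1 : par 1 = false.
Proof. by rewrite /par len1. Qed.

Lemma parV w : par w^-1 = par w.
Proof. by rewrite /par lenV. Qed.

Lemma par_gen (s : I) : par (val s).
Proof.
have [//|p [pM p1]] := @lift_bool xpredT.
rewrite /par; have := len_gen s; case E: (len _) => [|[|//]] // _.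
have := p1 s; rewrite (len_eq0 E) /=; have := pM 1 1; rewrite mulg1.
by case: (p 1).
Qed.

Lemma parJ x w : par (x ^ w) = par x.
Proof. by rewrite conjgE !par_morph parV addbCA addbb addbF. Qed.

Lemma gen_neq1 (s : I) : val s != 1.
Proof. by apply/eqP => s1; have := par_gen s; rewrite s1 par1. Qed.

(** The two lengths differ by at most one, and parity excludes equality. *)
Lemma len_mul_gen (s : I) w :
  len (val s * w) = (len w).+1 \/ len w = (len (val s * w)).+1.
Proof.
have le1 := leq_trans (lenM (val s) w) (leq_add (len_gen s) (leqnn _)).
have := leq_trans (lenM (val s) (val s * w)) (leq_add (len_gen s) (leqnn _)).
rewrite genKl add1n => le2; rewrite add1n in le1.
have : par (val s * w) != par w by rewrite par_morph par_gen; case: (par w).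
rewrite /par; have [lt|lt|->] := ltngtP (len (val s * w)) (len w).
- by right; apply/eqP; rewrite eqn_leq le2.
- by left; apply/eqP; rewrite eqn_leq le1.
- by rewrite eqxx.
Qed.

Lemma len_descent w : w <> 1 -> exists s : I, (len (val s * w) < len w)%N.
Proof.
have [[|s u] lenu evu] := len_word w; first by rewrite -evu ev_nil.
by move=> _; exists s; rewrite -lenu -evu ev_cons genKl ltnS len_ev.
Qed.

Fixpoint alt (s t : I) k := if k is k'.+1 then s :: alt t s k' else [::].

Lemma size_alt s t k : size (alt s t k) = k.
Proof. by elim: k s t => //= k IHk s t; rewrite IHk. Qed.

Lemma ev_alt_swap (s t : I) k :
  ev (alt s t k) = (val s * val t) ^+ k * ev (alt t s k).
Proof.
elim: k s t => [|k IHk] s t; first by rewrite expg0 mul1g.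
have swap: val s * (val t * val s) ^+ k = (val s * val t) ^+ k * val s.
  elim: {IHk} k => [|k IHk]; first by rewrite !expg0 mulg1 mul1g.
  by rewrite expgSr mulgA IHk (expgSr (val s * val t)) -!mulgA.
rewrite /= !ev_cons {1}IHk mulgA swap expgSr -!mulgA.
by rewrite [val t * (val t * _)]genKl.
Qed.

Lemma alt_cat s t j k :
  alt s t (j + k) =
  alt s t j ++ (if odd j then alt t s k else alt s t k).
Proof.
by elim: j s t => //= j IHj s t; rewrite IHj; case: (odd j).
Qed.

Lemma alt_braid (s t : I) n : cox_ord s t = Some n ->
  ev (alt s t n) = ev (alt t s n).
Proof. by move=> /gen_rel mst; rewrite ev_alt_swap mst mul1g. Qed.

End Length.

(** * The contragredient geometric representation *)

Section Chebyshev.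

(** Chebyshev polynomials of the second kind with shifted index, U_{k-2}(c/2); starting from U_{-2}
    = -1 lets the formulas of [foldr_alt] hold from the empty word on. *)
Fixpoint cheb (c : R) k : R :=
  if k is k'.+1 then
    (if k' is k''.+1 then c * cheb c k' - cheb c k'' else 0)%Re
  else (-1)%Re.

Lemma chebS c k : cheb c k.+2 = (c * cheb c k.+1 - cheb c k)%Re.
Proof. by []. Qed.

Lemma cheb_sin a k :
  (cheb (2 * cos a) k * sin a = sin ((INR k - 1) * a))%Re.
Proof.
suff: (cheb (2 * cos a) k * sin a = sin ((INR k - 1) * a) /\
       cheb (2 * cos a) k.+1 * sin a = sin ((INR k.+1 - 1) * a))%Re by case.
elim: k => [|k [IH1 IH2]].
  split; first by rewrite /= (_ : (0 - 1) * a = - a)%Re ?sin_neg; lra.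
  by rewrite /= (_ : (1 - 1) * a = 0)%Re ?sin_0; lra.
split=> //; rewrite chebS Rmult_minus_distr_r IH1 Rmult_assoc IH2.
rewrite (_ : (INR k.+2 - 1) * a = (INR k.+1 - 1) * a + a)%Re; last first.
  by rewrite (S_INR k.+1); lra.
rewrite (_ : (INR k - 1) * a = (INR k.+1 - 1) * a - a)%Re; last first.
  by rewrite (S_INR k); lra.
by rewrite sin_plus sin_minus; lra.
Qed.

Lemma cheb2 k : cheb 2 k = (INR k - 1)%Re.
Proof.
suff: (cheb 2 k = INR k - 1 /\ cheb 2 k.+1 = INR k.+1 - 1)%Re by case.
elim: k => [|k [IH1 IH2]]; first by split=> /=; lra.
by split=> //; rewrite chebS IH1 IH2 !S_INR; lra.
Qed.

Section Angle.
Variable n : nat.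
Hypothesis n_ge2 : (2 <= n)%N.

Let a := (PI / INR n)%Re.
Let c := (2 * cos a)%Re.

Let INRn : (2 <= INR n)%Re.
Proof. by move/leP/le_INR: n_ge2. Qed.

Let na : (INR n * a = PI)%Re.
Proof. by rewrite /a; field; lra. Qed.

Let a_gt0 : (0 < a)%Re.
Proof. by apply: Rdiv_lt_0_compat; [exact: PI_RGT_0 | lra]. Qed.

Let a_le : (a <= PI / 2)%Re.
Proof. by have := na; nra. Qed.

Let sin_gt0 : (0 < sin a)%Re.
Proof. by apply: sin_gt_0 => //; have := PI_RGT_0; have := a_le; lra. Qed.

Lemma cos_angle_ge0 : (0 <= c)%Re.
Proof.
suff: (0 <= cos a)%Re by rewrite /c; lra.
by apply: cos_ge_0; have := a_gt0; have := a_le; have := PI_RGT_0; lra.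
Qed.

Lemma cos_angle_gt0 : (3 <= n)%N -> (0 < c)%Re.
Proof.
move=> /leP/le_INR n3; suff: (0 < cos a)%Re by rewrite /c; lra.
have : (a < PI / 2)%Re by have := na; have := PI_RGT_0; move: n3; simpl; nra.
by move=> a_lt; apply: cos_gt_0 => //; have := a_gt0; have := PI_RGT_0; lra.
Qed.

Lemma cos_angle_lt2 : (c < 2)%Re.
Proof.
have := sin2_cos2 a; rewrite /Rsqr /c => e.
by have := sin_gt0; have := cos_angle_ge0; rewrite /c; nra.
Qed.

(** For these [k] the angle [(k - 1) * a] lies between 0 and pi. *)
Lemma cheb_angle_ge0 k : (1 <= k <= n.+1)%N -> (0 <= cheb c k)%Re.
Proof.
case/andP=> /leP/le_INR k1 /leP/le_INR; rewrite S_INR => kn.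
apply: (Rmult_le_reg_r (sin a)) => //; rewrite Rmult_0_l cheb_sin.
apply: sin_ge_0; first by have := a_gt0; move: k1; simpl; nra.
by rewrite -na; apply: Rmult_le_compat_r; have := a_gt0; lra.
Qed.

(** After [2n] steps the angle has advanced by a full turn, so the initial values -1, 0, 1 recur. *)
Lemma cheb_angle_period :
  [/\ cheb c n.*2 = (-1)%Re, cheb c n.*2.+1 = 0%Re & cheb c n.*2.+2 = 1%Re].
Proof.
have e k : cheb c k = (sin ((INR k - 1) * a) / sin a)%Re.
  by rewrite -cheb_sin -/c; field; have := sin_gt0; lra.
have n2 : (INR n.*2 * a = 2 * PI)%Re.
  by rewrite -addnn plus_INR -na; ring.
rewrite !e !S_INR; split.
- rewrite (_ : _ * a = - (a - 2 * INR 1 * PI))%Re; last by simpl; lra.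
  rewrite sin_neg -(sin_period _ 1) (_ : a - _ + _ = a)%Re; last by ring.
  by field; have := sin_gt0; lra.
- rewrite (_ : _ * a = 2 * PI)%Re; last lra.
  by rewrite sin_2PI; field; have := sin_gt0; lra.
- rewrite (_ : _ * a = a + 2 * INR 1 * PI)%Re; last by simpl; lra.
  by rewrite sin_period; field; have := sin_gt0; lra.
Qed.

End Angle.
End Chebyshev.

(** * The representation and its defining relations *)

Section Representation.
Variables (W : groupType) (C : coxeterSystem W).

Notation I := (cox_gens C).

(* The absolute values of the off-diagonal entries of the Cartan matrix; the
   formula gives -2 on the diagonal, where the order is 1. *)
Definition cartan (s t : I) : R :=
  if cox_ord s t is Some n then (2 * cos (PI / INR n))%Re else 2%Re.

Lemma cartanC s t : cartan s t = cartan t s.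
Proof. by rewrite /cartan cox_ordC. Qed.

Lemma cartan_diag s : cartan s s = (-2)%Re.
Proof.
rewrite /cartan cox_ord_diag (_ : PI / INR 1 = PI)%Re ?cos_PI; first by ring.
by simpl; field.
Qed.

(* The contragredient of the geometric representation, in the coordinates given
   by the values of a linear form on the simple roots. *)
Definition refl (s : I) (x : I -> R) : I -> R :=
  fun t => (x t + cartan s t * x s)%Re.

(** The coordinates at [s] and [t] transform among themselves, by a matrix with Chebyshev entries;
    the induction exchanges the roles of [s] and [t]. *)
Lemma foldr_alt s t k (y : I -> R) (c := cartan s t) :
  foldr refl y (alt s t k) t =
    (if odd k then cheb c k.+1 * y t + cheb c k.+2 * y s
     else cheb c k.+2 * y t + cheb c k.+1 * y s)%Re /\
  foldr refl y (alt s t k) s =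
    (- if odd k then cheb c k.+1 * y s + cheb c k * y t
       else cheb c k * y s + cheb c k.+1 * y t)%Re.
Proof.
rewrite {}/c; elim: k s t => [|k IHk] s t; first by split=> /=; lra.
have [IHs IHt] := IHk t s; move: IHs IHt.
rewrite [alt s t _]/= [foldr _ _ (_ :: _)]/= /refl !chebS cartan_diag (cartanC
  t s).
by move=> -> ->; rewrite /=; case: (odd k) => /=; lra.
Qed.

Lemma foldr_alt_double s t k (y : I -> R) :
  foldr refl y (alt s t k.*2) = iter k (refl s \o refl t) y.
Proof. by elim: k => //= k <-. Qed.

(** For distinct [s], [t], periodicity of [cheb] restores these two coordinates. Every other
    coordinate is controlled by an invariant linear form, which exists because finite order gives
    [c < 2], so that [4 - c * c] is nonzero. *)
Lemma refl_rel s t n : cox_ord s t = Some n ->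
  iter n (refl s \o refl t) =1 id.
Proof.
move=> mst x; have [st|st] := eqVneq s t.
  move: mst; rewrite st cox_ord_diag => -[<-]; apply/funext => q /=.
  by rewrite /refl cartan_diag; ring.
have n2 := cox_ord_ge2 st mst.
have [c0 c1 c2] := cheb_angle_period n2; have clt := cos_angle_lt2 n2.
have cge := cos_angle_ge0 n2.
have [xt xs] := foldr_alt s t n.*2 x; move: xt xs.
rewrite odd_double {1 2 3 4}/cartan mst c0 c1 c2 => xt xs.
apply/funext => q; rewrite -foldr_alt_double.
pose c := cartan s t; have cE : c = (2 * cos (PI / INR n))%Re.
  by rewrite /c /cartan mst.
move: clt cge; rewrite -cE => clt cge.
pose l := ((2 * cartan s q + cartan t q * c) / (4 - c * c))%Re.
pose m := ((2 * cartan t q + cartan s q * c) / (4 - c * c))%Re.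
(* l and m make x q + l * x s + m * x t invariant under s and t. *)
have d : (4 - c * c <> 0)%Re by nra.
have inv k y : (foldr refl y (alt s t k) q + l * foldr refl y (alt s t k) s +
    m * foldr refl y (alt s t k) t = y q + l * y s + m * y t)%Re.
  suff inv2 : forall k, (foldr refl y (alt s t k) q +
      l * foldr refl y (alt s t k) s + m * foldr refl y (alt s t k) t =
      y q + l * y s + m * y t)%Re /\ (foldr refl y (alt t s k) q +
      l * foldr refl y (alt t s k) s + m * foldr refl y (alt t s k) t =
      y q + l * y s + m * y t)%Re by case: (inv2 k).
  elim=> // j [IH1 IH2]; split; [rewrite -IH2|rewrite -IH1];
    rewrite [alt _ _ _]/= [foldr _ _ (_ :: _)]/= /refl !cartan_diag.
    by rewrite -/c /l /m; field.
  by rewrite (cartanC t s) -/c /l /m; field.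
by have := inv n.*2 x; rewrite xt xs; lra.
Qed.

End Representation.

(** * The Tits cone *)

Section TitsCone.
Variables (W : groupType) (C : coxeterSystem W).

Notation I := (cox_gens C).

Definition rep : W -> (I -> R) -> I -> R :=
  projT1 (cid (lift_action (@refl_rel W C))).

Lemma rep1 x : rep 1 x = x.
Proof. by rewrite /rep; case: cid => a []. Qed.

Lemma repM g h x : rep (g * h) x = rep g (rep h x).
Proof. by rewrite /rep; case: cid => a []. Qed.

Lemma rep_gen (s : I) : rep (val s) = refl s.
Proof. by rewrite /rep; case: cid => a []. Qed.

Lemma repK w : cancel (rep w) (rep w^-1).
Proof. by move=> x; rewrite -repM mulVg rep1. Qed.

Lemma repVK w : cancel (rep w^-1) (rep w).
Proof. by move=> x; rewrite -repM mulgV rep1. Qed.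

Lemma rep_ev (u : seq I) x : rep (ev u) x = foldr (@refl W C) x u.
Proof.
by elim: u => [|s u IHu]; rewrite ?ev_nil ?rep1 // ev_cons repM IHu rep_gen.
Qed.

Lemma rep_linear w a x y :
  rep w (fun s => a * x s + y s)%Re = (fun s => a * rep w x s + rep w y s)%Re.
Proof.
elim/(@gen_ind W C): w => [|s w IHw]; first by rewrite !rep1.
by rewrite !repM IHw rep_gen; apply/funext => t; rewrite /refl; ring.
Qed.

Lemma repZ w a x : rep w (fun s => a * x s)%Re = (fun s => a * rep w x s)%Re.
Proof.
elim/(@gen_ind W C): w => [|s w IHw]; first by rewrite !rep1.
by rewrite !repM IHw rep_gen; apply/funext => t; rewrite /refl; ring.
Qed.

Definition dominant (x : I -> R) := forall s, (0 <= x s)%Re.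

(** [rep w x s] is the value of [x] on the image of the simple root of [s] under the inverse of [w],
    so this is positivity of roots. Split off from [w] the longest length-additive alternating
    prefix in [t], [s]: the remainder [w'] is lengthened by both generators, induction applies to
    it, and the Chebyshev coefficients of the prefix are nonnegative. *)
Theorem rep_ascent w s x :
  (len C w < len C (val s * w))%N -> dominant x -> (0 <= rep w x s)%Re.
Proof.
move=> + x0; have [n] := ubnP (len C w); elim: n w s => // n IHn w s lewn asc.
have [->|/(@len_descent _ C)[t dsc]] := EM (w = 1).
  by rewrite rep1; exact: x0.
pose P k := `[< exists2 w', w = ev (alt t s k) * w' &
  len C w = (k + len C w')%N >].
have exP : exists k, P k.
  by exists 0%N; apply/asboolP; exists w; rewrite ?ev_nil ?mul1g.
have ubP k : P k -> (k <= len C w)%N by case/asboolP => w' _ ->;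
  rewrite leq_addr.
case: (ex_maxnP exP ubP) => k /asboolP[w' wE lenE] kmax.
have k_gt0 : (0 < k)%N.
  apply: kmax; apply/asboolP; exists (val t * w).
    by rewrite ev1 genKl.
  by case: (len_mul_gen t w) dsc => [->|-> _]; rewrite ?add1n // ltnNge leqnSn.
(* [k] is maximal, so the letter continuing the prefix cannot shorten [w']. *)
have asc_next : (len C w' < len C (val (if odd k then s else t) * w'))%N.
  case: (len_mul_gen (if odd k then s else t) w') => [->//|lenE'].
  have : P k.+1.
    apply/asboolP; exists (val (if odd k then s else t) * w').
      rewrite -addn1 alt_cat ev_cat -mulgA.
      by rewrite wE; case: ifP => _; rewrite ev1 genKl.
    by rewrite lenE lenE' addnS.
  by move/kmax; rewrite ltnn.
(* If the last letter of the prefix shortened [w'], absorbing it would give a word for [w] that is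
   too short. *)
have asc_last : (len C w' < len C (val (if odd k then t else s) * w'))%N.
  case: (len_mul_gen (if odd k then t else s) w') => [->//|lenE'].
  case: k k_gt0 wE lenE lenE' {kmax asc_next} => // k _ wE lenE lenE'.
  have : (len C w <= k + len C (val (if odd k.+1 then t else s) * w'))%N.
    have -> : w = ev (alt t s k) * (val (if odd k.+1 then t else s) * w').
      rewrite wE -addn1 alt_cat ev_cat -mulgA addn1 /=.
      by case: (odd k) => /=; rewrite ev1.
    by apply: leq_trans (lenM _ _ _) _;
      rewrite leq_add2r (leq_trans (len_ev _)) ?size_alt.
  by rewrite lenE lenE' addSnnS leq_add2l ltnNge leqnSn.
have lt_w' : (len C w' < n)%N.
  by rewrite -ltnS (leq_trans _ lewn) // ltnS lenE -[X in (X < _)%N]add0n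
    ltn_add2r.
have xs : (0 <= rep w' x s)%Re.
  by apply: IHn => //; case: (odd k) asc_next asc_last.
have xt : (0 <= rep w' x t)%Re.
  by apply: IHn => //; case: (odd k) asc_next asc_last.
have [_ xsE] := foldr_alt t s k (rep w' x).
have [xsE' _] := foldr_alt t s k (rep w' x).
rewrite wE repM rep_ev xsE'.
suff [c1 c2] : (0 <= cheb (cartan t s) k.+1)%Re /\
  (0 <= cheb (cartan t s) k.+2)%Re.
  by case: (odd k); apply: Rplus_le_le_0_compat; exact: Rmult_le_pos.
rewrite /cartan; case mts: (cox_ord t s) => [n0|]; last first.
  by rewrite !cheb2 !S_INR; have := pos_INR k; lra.
have ts : t != s by apply: contraTneq asc => <-; rewrite -leqNgt ltnW.
have n02 := cox_ord_ge2 ts mts.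
suff ltk : (k < n0)%N.
  by split; apply: cheb_angle_ge0 => //; rewrite /= ltnS ?ltk ?(ltnW ltk).
(* A prefix with at least [n0] letters could be rewritten by the braid relation to begin with [s],
   so [s] would not lengthen [w]. *)
rewrite ltnNge; apply/negP => lek; move: asc; rewrite ltnNge => /negP; apply.
case: n0 mts n02 lek => // n0 mts _ lek.
have -> : val s * w = ev (alt t s n0) *
    (ev (if odd n0.+1 then alt s t (k - n0.+1) else alt t s (k - n0.+1)) * w').
  rewrite wE -{1}(subnKC lek) alt_cat ev_cat (alt_braid mts) [alt s t n0.+1]/=.
  by rewrite ev_cons -!mulgA genKl.
apply: leq_trans (lenM _ _ _) _; rewrite lenE.
rewrite -[X in (_ <= X + _)%N](subnKC lek) -addnA leq_add //.
  by rewrite (leq_trans (len_ev _)) // size_alt leqnSn.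
apply: leq_trans (lenM _ _ _) _; rewrite leq_add2r.
by rewrite (leq_trans (len_ev _)) //; case: ifP; rewrite size_alt.
Qed.

End TitsCone.

(** * Chambers and convexity of the Tits cone *)

Section Chambers.
Variables (W : groupType) (C : coxeterSystem W).

Notation I := (cox_gens C).

Lemma finite_bound (T : finType) (f : T -> R) :
  exists K, forall t, (Rabs (f t) <= K)%Re.
Proof.
suff [K KP] : exists K, forall t, t \in enum T -> (Rabs (f t) <= K)%Re.
  by exists K => t; apply: KP; rewrite mem_enum.
elim: (enum T) => [|a r [K KP]]; first by exists 0%Re.
exists (Rmax (Rabs (f a)) K) => t; rewrite inE => /orP[/eqP->|/KP tK].
  exact: Rmax_l.
exact: Rle_trans tK (Rmax_r _ _).
Qed.

Lemma finite_min (T : finType) (P : pred T) (f : T -> R) t0 : P t0 ->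
  exists2 t, P t & forall u, P u -> (f t <= f u)%Re.
Proof.
move=> Pt0; have t0E : t0 \in enum T by rewrite mem_enum.
suff [t Pt tP] : exists2 t, P t &
    forall u, u \in enum T -> P u -> (f t <= f u)%Re.
  by exists t => // u Pu; apply: tP; rewrite ?mem_enum.
elim: (enum T) t0 Pt0 t0E => // a r IHr t0 Pt0.
have [[u ur Pu]|noP] := EM (exists2 u, u \in r & P u).
  move=> _; have [t Pt tP] := IHr u Pu ur.
  have [Pa|Pa] := boolP (P a); last first.
    by exists t => // v; rewrite inE => /orP[/eqP->|];
      [rewrite (negPf Pa)|exact: tP].
  have [le|le] := Rle_dec (f a) (f t).
    exists a => // v; rewrite inE => /orP[/eqP-> _|vr Pv]; first lra.
    exact: Rle_trans le (tP _ vr Pv).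
  exists t => // v; rewrite inE => /orP[/eqP-> _|]; [lra|exact: tP].
rewrite inE => /orP[/eqP<-|t0r]; last by case: noP; exists t0.
exists t0 => // u; rewrite inE => /orP[/eqP-> _|ur Pu]; first lra.
by case: noP; exists u.
Qed.

Lemma rep_descentE w (s : I) x : (rep (val s * w) x s = - rep w x s)%Re.
Proof. by rewrite repM rep_gen /refl cartan_diag; ring. Qed.

Definition rho : I -> R := fun=> 1%Re.

Lemma rho_dominant : dominant rho. Proof. by move=> s; rewrite /rho; lra. Qed.

(** If the value were 0, take [x] sent by [w] to the constant -1: then [K * rho + x] is dominant for
    large [K], but its image is -1 at [s]. *)
Lemma rep_ascent_rho w (s : I) :
  (len C w < len C (val s * w))%N -> (0 < rep w rho s)%Re.
Proof.
move=> asc; have := rep_ascent asc rho_dominant.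
move/Rle_lt_or_eq_dec => [//|/esym rho0].
pose x : I -> R := rep w^-1 (fun=> (-1)%Re); have [K KP] := finite_bound x.
have /(rep_ascent asc) : dominant (fun t => K * rho t + x t)%Re.
  by move=> t; have := KP t; have := Rle_abs (- x t); rewrite Rabs_Ropp /rho;
    lra.
by rewrite rep_linear repVK rho0; lra.
Qed.

Lemma rep_descent_rho w (s : I) :
  (len C (val s * w) < len C w)%N -> (rep w rho s < 0)%Re.
Proof.
move=> dsc; have := @rep_ascent_rho (val s * w) s; rewrite genKl rep_descentE.
by move/(_ dsc); lra.
Qed.

Lemma rep_dominant_descent w (s : I) x :
  dominant x -> (rep w x s < 0)%Re -> (len C (val s * w) < len C w)%N.
Proof.
move=> x0 lt0; rewrite ltnNge; apply/negP => le.
have asc : (len C w < len C (val s * w))%N.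
  by case: (len_mul_gen s w) le => [->|->] //; rewrite ltnn.
by have := rep_ascent asc x0; lra.
Qed.

Lemma rep_faithful w : rep w = @id (I -> R) -> w = 1.
Proof.
move=> wid; have [//|/(@len_descent _ C)[s dsc]] := EM (w = 1).
by have := rep_descent_rho dsc; rewrite wid /rho; lra.
Qed.

(** [cox_ord] is a priori only the exponent of a relator. The indicator vector of [s] tells the two
    products apart once [cartan s t] is positive, that is, for [n >= 3]. *)
Lemma commute_order2 (s t : I) n : s != t -> cox_ord s t = Some n ->
  val s * val t = val t * val s -> n = 2%N.
Proof.
move=> st mst com; have n2 := cox_ord_ge2 st mst.
have := n2; rewrite leq_eqVlt => /orP[/eqP//|n3].
have := cos_angle_gt0 n2 n3; pose x q := (if q == s then 1 else 0)%Re.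
have : rep (val s * val t) x t = rep (val t * val s) x t by rewrite com.
rewrite !repM !rep_gen /refl !cartan_diag (cartanC t s) /x eqxx.
by rewrite eq_sym (negPf st) /cartan mst; lra.
Qed.

(** With Cartan entry 2, the n-th power sends [rho] to a vector whose coordinate at [t] is
    [4 * n + 1]. *)
Lemma infinite_order (s t : I) n : s != t -> cox_ord s t = None ->
  (val s * val t) ^+ n = 1 -> n = 0%N.
Proof.
move=> st mst stn.
have : rep ((val s * val t) ^+ n) rho t = rho t by rewrite stn rep1.
have -> : (val s * val t) ^+ n = ev (alt s t n.*2).
  elim: (n) => [|k IHk]; first by rewrite ev_nil.
  by rewrite expgS IHk doubleS /= !ev_cons mulgA.
have [e _] := foldr_alt s t n.*2 rho; rewrite rep_ev e odd_double.
rewrite /cartan mst !cheb2 !S_INR -addnn plus_INR /rho => {}e.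
by apply: INR_eq; simpl; lra.
Qed.

Definition titsCone (x : I -> R) := exists w, dominant (rep w x).

Lemma titsCone_rep w x : titsCone (rep w x) -> titsCone x.
Proof. by case=> g gx; exists (g * w); rewrite repM. Qed.

(* The segment from x to y leaves the dominant chamber through the wall of s;
   reflecting in it fixes the exit point and brings y one chamber closer. *)
Lemma titsCone_dominant_add w x y : dominant x -> dominant y ->
  titsCone (fun t => x t + rep w y t)%Re.
Proof.
have [n] := ubnP (len C w); elim: n w x y => // n IHn w x y lewn x0 y0.
set z := fun t => _.
have [z0|] := EM (dominant z); first by exists 1; rewrite rep1.
move/existsNP => [s1 /Rnot_le_lt zs1].
pose P s : bool := `[< (rep w y s < 0)%Re >].
have Ps1 : P s1 by apply/asboolP; have := x0 s1; move: zs1; rewrite /z; lra.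
(* [f s] is the parameter at which [x + f s * rep w y] meets the wall of [s]; the smallest one gives
   the exit point [x'], still dominant, and [z] splits as [x' + rep w y']. *)
pose f s := (x s / - rep w y s)%Re.
have [s /asboolP ys smin] := finite_min f Ps1.
have fP u : rep w y u <> 0%Re -> (x u = - f u * rep w y u)%Re.
  by move=> nz; rewrite /f; field.
have f0 u : P u -> (0 <= f u)%Re.
  move/asboolP => uy; apply: Rle_mult_inv_pos; [exact: x0|lra].
have fs1 : (f s < 1)%Re.
  apply: Rle_lt_trans (smin _ Ps1) _; move/asboolP: Ps1 => ys1.
  have := fP s1; move: zs1; rewrite /z; nra.
have fs0 : (0 <= f s)%Re by apply: f0; apply/asboolP.
pose x' t := (f s * rep w y t + x t)%Re.
pose y' t := ((1 - f s) * y t)%Re.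
have x'0 : dominant x'.
  move=> t; rewrite /x'; have := x0 t.
  have [yt|] := Rlt_dec (rep w y t) 0; last by move=> /Rnot_lt_le; nra.
  have /smin : P t by apply/asboolP.
  have := fP t; nra.
have y'0 : dominant y' by move=> t; rewrite /y'; have := y0 t; nra.
have x's : x' s = 0%Re by rewrite /x' [X in (_ + X)%Re]fP; lra.
apply: (@titsCone_rep (val s)).
rewrite (_ : rep (val s) z = fun t => (x' t + rep (val s * w) y' t)%Re).
  apply: IHn => //; rewrite -ltnS; apply: leq_trans lewn; rewrite ltnS.
  exact: rep_dominant_descent ys.
apply/funext => t; rewrite repM /y' repZ.
rewrite rep_gen /refl /z; move: x's; rewrite /x' => x's.
have -> : x s = (- f s * rep w y s)%Re by lra.
ring.
Qed.

(** Translating by [g] makes the first summand dominant; the factor 1 gives the sum the shape of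
    [rep_linear]. *)
Lemma titsCone_add x y :
  titsCone x -> titsCone y -> titsCone (fun t => 1 * x t + y t)%Re.
Proof.
move=> [g gx] [h hy]; apply: (@titsCone_rep g); rewrite rep_linear.
have -> : rep g y = rep (g * h^-1) (rep h y) by rewrite repM repK.
have := titsCone_dominant_add (g * h^-1) gx hy.
by congr titsCone; apply/funext => t; ring.
Qed.

End Chambers.

(** * Finite subgroups *)

Section Subgroups.
Variable W : groupType.
Implicit Types (H T : set W) (x y : W).

Lemma generated_subgroup T : is_subgroup (generated T).
Proof.
split=> [H [[H1 _ _] _] //|x y Hx Hy H HP|x Hx H HP].
  by have [[_ HM _] _] := HP; apply: HM; [exact: Hx|exact: Hy].
by have [[_ _ HV] _] := HP; apply: HV; exact: Hx.
Qed.

Lemma sub_generated T : T `<=` generated T.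
Proof. exact: sub_gen_smallest. Qed.

Lemma generated_min H T : is_subgroup H -> T `<=` H -> generated T `<=` H.
Proof. by move=> HH TH; exact: smallest_sub. Qed.

Lemma subgroupX H x n : is_subgroup H -> H x -> H (x ^+ n).
Proof.
by case=> H1 HM _ Hx; elim: n => [|n IHn]; rewrite ?expg0 ?expgS //; exact: HM.
Qed.

End Subgroups.

HB.instance Definition _ := Monoid.isComLaw.Build R 0%Re Rplus
  (fun x y z => esym (Rplus_assoc x y z)) Rplus_comm Rplus_0_l.

(** * Stabilizers of dominant vectors and orbit sums *)

Section FiniteSubgroups.
Variables (W : groupType) (C : coxeterSystem W).

Notation I := (cox_gens C).
Notation len := (len C).

Definition stab (v : I -> R) : set W := [set a | rep a v = v].

Lemma stab_subgroup v : is_subgroup (stab v).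
Proof.
split=> [|x y xv yv|x xv]; rewrite /stab /= ?rep1 //.
  by rewrite repM yv xv.
by rewrite -{1}xv repK.
Qed.

Lemma stab_rep w v a : stab (rep w v) a <-> stab v (a ^ w).
Proof.
rewrite /stab /= conjgE !repM; split=> [->|e]; first exact: repK.
by rewrite -{2}e repVK.
Qed.

(** Since [a] fixes [v], a descent [s] of [a] gives [v s <= 0] by [rep_ascent]; dominance makes it
    0, so [s] fixes [v] and can be stripped off. *)
Lemma stab_word v a : dominant v -> stab v a ->
  exists2 u : seq I, ev u = a /\ size u = len a & forall s, s \in u ->
    v s = 0%Re.
Proof.
move=> v0; have [n] := ubnP (len a); elim: n a => // n IHn a lean av.
have [->|/(@len_descent _ C)[s dsc]] := EM (a = 1).
  by exists [::] => //; rewrite ev_nil len1.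
have vs : v s = 0%Re.
  have : (len (val s * a) < len (val s * (val s * a)))%N by rewrite genKl.
  by move/rep_ascent/(_ v0); rewrite rep_descentE av; have := v0 s; lra.
have [||u [evu sizeu] u0] := IHn (val s * a).
- by apply: leq_trans dsc _; rewrite -ltnS.
- rewrite /stab /= repM av rep_gen; apply/funext => t.
  by rewrite /refl vs; ring.
exists (s :: u); first split; rewrite /= ?ev_cons ?evu ?genKl ?sizeu //.
  by case: (len_mul_gen s a) dsc => [->|-> //]; rewrite ltnNge leqnSn.
by move=> t; rewrite inE => /orP[/eqP->|/u0].
Qed.

Lemma finite_len n : finite_set [set a | (len a <= n)%N].
Proof.
apply: (@sub_finite_set _ _ (\bigcup_(k in `I_n.+1)
  [set ev (val t) | t in [set: k.-tuple I]])).
  move=> a /= le; have [u sizeu evu] := len_word C a.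
  exists (len a) => //; exists (@Tuple _ _ u (introT eqP sizeu)) => //.
by apply: bigcup_finite => [|k _]; [exact: finite_II|exact: finite_image].
Qed.

Definition sumrep (ws : seq W) : I -> R :=
  fun t => \big[Rplus/0%Re]_(w <- ws) rep w (@rho W C) t.

Lemma sumrep_cons w ws :
  sumrep (w :: ws) = (fun t => 1 * rep w (@rho W C) t + sumrep ws t)%Re.
Proof. by apply/funext => t; rewrite /sumrep big_cons Rmult_1_l. Qed.

Lemma rep_sumrep g ws : rep g (sumrep ws) = sumrep [seq g * w | w <- ws].
Proof.
elim: ws => [|w ws IHws] /=; last by rewrite !sumrep_cons rep_linear IHws repM.
have -> : sumrep [::] = (fun t => 0 * @rho W C t)%Re.
  by apply/funext => t; rewrite /sumrep big_nil; ring.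
by rewrite repZ; apply/funext => t; ring.
Qed.

Lemma titsCone_sumrep ws : titsCone (sumrep ws).
Proof.
elim: ws => [|w ws IHws].
  by exists 1; rewrite rep1 => t; rewrite /sumrep big_nil; lra.
rewrite sumrep_cons; apply: titsCone_add IHws.
by exists w^-1; rewrite repK; exact: rho_dominant.
Qed.

Lemma sumrep_eq0_descent ws s : ws != [::] -> sumrep ws s = 0%Re ->
  exists2 w, w \in ws & (len (val s * w) < len w)%N.
Proof.
move=> ws0 v0; apply: contrapT => none.
have pos w : w \in ws -> (0 < rep w (@rho W C) s)%Re.
  move=> wws; apply: rep_ascent_rho; case: (len_mul_gen s w) => [->//|lenE].
  by case: none; exists w; rewrite // [X in (_ < X)%N]lenE.
suff : (0 < sumrep ws s)%Re by lra.
elim: ws ws0 pos {v0 none} => // w ws IHws _ pos.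
rewrite sumrep_cons; have := pos w (mem_head _ _).
have [->|ws0] := eqVneq ws [::]; first by rewrite /sumrep big_nil; lra.
have := IHws ws0 (fun x xws => pos x (@mem_behead _ (w :: ws) x xws)); lra.
Qed.

(** The term at [w] drops where the crude bound allows a rise of one, which saves two. *)
Lemma leq_sum_step (T : eqType) (f g : T -> nat) ws w : w \in ws ->
  (f w < g w)%N ->
  (forall x, (f x <= (g x).+1)%N) ->
  (\sum_(x <- ws) f x + 2 <= \sum_(x <- ws) g x + size ws)%N.
Proof.
move=> + fgw fg; have le r : (\sum_(x <- r) f x <= \sum_(x <- r) g x + size
  r)%N.
  elim: r => [|x r IHr]; rewrite ?big_nil // !big_cons /=.
  by have := fg x; lia.
elim: ws => // x ws IHws; rewrite inE !big_cons /=.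
case/predU1P=> [<-|/IHws]; first by have := le ws; lia.
by have := fg x; lia.
Qed.

(** The length of a stabilizing [a] is at most [Phi 1]. Each letter of a reduced word of [a] is a
    descent of some term, so it raises [Phi] by at most [size ws - 2]; on the other hand [Phi a] is
    at least [size ws * len a - Phi 1]. *)
Lemma finite_stab_sumrep (ws : seq W) : ws != [::] -> dominant (sumrep ws) ->
  finite_set (stab (sumrep ws)).
Proof.
move=> ws0 v0; pose Phi (p : W) := (\sum_(w <- ws) len (p * w))%N.
apply: sub_finite_set (finite_len (Phi 1%g)) =>
  a /(stab_word v0)[u [evu sizeu] u0].
have step : rep (ev u) (sumrep ws) = sumrep ws /\
    (Phi (ev u) + 2 * size u <= Phi 1%g + size ws * size u)%N.
  elim: u u0 {evu sizeu} => [|s u IHu] u0.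
    by rewrite ev_nil rep1 !muln0.
  have [fixu le] := IHu (fun t tu => u0 t (@mem_behead _ (s :: u) t tu)).
  have vs := u0 s (mem_head _ _); split.
    by rewrite ev_cons repM fixu rep_gen; apply/funext => t; rewrite /refl vs;
      ring.
  have := vs; rewrite -fixu rep_sumrep =>
    /sumrep_eq0_descent[|_ /mapP[w wws ->] dsc].
    by case: (ws) ws0.
  have : (Phi (ev (s :: u)) + 2 <= Phi (ev u) + size ws)%N.
    apply: (leq_sum_step wws) => [|x]; rewrite ev_cons -mulgA //.
    by case: (len_mul_gen s (ev u * x)) => [->|->] //; exact: leqW (leqnSn _).
  rewrite /=; lia.
have low : (size ws * len a <= Phi a + Phi 1%g)%N.
  rewrite /Phi; elim: (ws) => [|w r IHr]; first by rewrite mul0n.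
  rewrite !big_cons /= mulSn addnACA leq_add // mul1g.
  by rewrite -{1}(mulgK w a) -(lenV C w) lenM.
case: step => _; rewrite evu sizeu => le /=.
nia.
Qed.

End FiniteSubgroups.

(** * Finite subgroups, spherical subsets and dimension *)

Section SphericalSubsets.
Variables (W : groupType) (C : coxeterSystem W).

Notation I := (cox_gens C).

(** The full stabilizer is kept in the conclusion, because elements not known to lie in [H] will
    later be shown to fix [v]. *)
Theorem finite_subgroup_stab (H : set W) : is_subgroup H -> finite_set H ->
  exists v : I -> R, [/\ H `<=` stab v, finite_set (stab v) &
    exists (x : W) (T : set W), spherical C T /\
      forall a, stab v a <-> generated T (a ^ x)].
Proof.
move=> [H1 HM HV] /finite_seqP[s HE].
(* Without repetitions, left multiplication by an element of [H] permutes the list, so [H] fixes the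
   orbit sum [v]. *)
pose hs := undup s; have hsP a : (a \in hs) = (a \in s) by rewrite mem_undup.
have hsH a : H a <-> a \in hs by rewrite HE hsP.
pose v : I -> R := sumrep hs.
have Hv a : H a -> rep a v = v.
  move=> Ha; rewrite /v rep_sumrep; apply/funext => t.
  apply: perm_big; apply: uniq_perm; rewrite ?undup_uniq //.
    by rewrite (map_inj_uniq (@mulgI _ a)) undup_uniq.
  move=> b; apply/mapP/idP => [[c /hsH Hc ->]|/hsH Hb]; first exact/hsH/HM.
  by exists (a^-1 * b); [apply/hsH/HM => //;
    exact: HV|rewrite mulgA mulgV mul1g].
have hs0 : hs != [::] by apply/eqP => hs0; have /hsH := H1; rewrite hs0.
have [w v0] := titsCone_sumrep C hs.
pose v1 := rep w v.
have fin1 : finite_set (stab v1).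
  rewrite /v1 /v rep_sumrep in v0 *; apply: finite_stab_sumrep => //.
  by case: (hs) hs0.
have v1E a : stab v a <-> stab v1 (a ^ w^-1).
  by rewrite stab_rep conjgKV.
exists v; split; first exact: Hv.
  apply: sub_finite_set (finite_image (fun a => a ^ w) fin1) => a /v1E va.
  by exists (a ^ w^-1) => //; rewrite conjgKV.
pose T : set W := [set val s | s in [set s | v1 s = 0%Re]].
have TE : generated T = stab v1.
  apply/seteqP; split=> [|a].
    apply: generated_min (stab_subgroup v1) _ => _ [t /= vt <-].
    by rewrite /stab /= rep_gen; apply/funext => q; rewrite /refl vt; ring.
  move=> /(stab_word v0)[u [<- _] u0]; have [T1 TM _] := generated_subgroup T.
  elim: u u0 => [|t u IHu] u0; rewrite ?ev_nil // ev_cons; apply: TM.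
    by apply: sub_generated; exists t => //; apply: u0; rewrite mem_head.
  by apply: IHu => q qu; apply: u0; rewrite inE qu orbT.
exists w^-1, T; rewrite TE; split=> //; split; last by rewrite TE.
by move=> _ [t _ <-]; exact: valP.
Qed.

Lemma generated_sub (T T' : set W) : T `<=` T' -> generated T `<=` generated T'.
Proof.
move=> TT'; apply: generated_min (generated_subgroup T') _ => x /TT'.
exact: sub_generated.
Qed.

(** The indicator vector of [s] is fixed by every other generator but not by [s]. *)
Lemma generated_gen (T : set W) (s : I) :
  T `<=` [set` cox_gens C] -> generated T (val s) -> T (val s).
Proof.
move=> TS Ts; apply: contrapT => nTs.
pose x : I -> R := fun t => (if t == s then 1 else 0)%Re.
have : generated T `<=` stab x.
  apply: generated_min (stab_subgroup x) _ => a Ta.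
  have aS : a \in cox_gens C := TS a Ta.
  have as0 : [` aS]%fset != s by apply/eqP => e; apply: nTs; rewrite -e.
  rewrite /stab /= -[a]/(val [` aS]%fset) rep_gen; apply/funext => t.
  by rewrite /refl [x [` _]%fset]/x (negPf as0); ring.
move=> /(_ _ Ts); rewrite /stab /= rep_gen => /(congr1 (fun y => y s)).
by rewrite /refl /x eqxx cartan_diag; lra.
Qed.

Definition small_spherical := forall (T : set W) a b c, spherical C T ->
  T a -> T b -> T c -> [\/ a = b, a = c | b = c].

(** Three distinct generators in a spherical set would yield a chain of four subgroups, strict by
    [generated_gen], hence a 3-simplex. *)
Lemma davis_small_spherical : davis_dim_eq C 2 -> small_spherical.
Proof.
move=> [_ dim2] T a b c [TS Tfin] Ta Tb Tc; apply: contrapT => abc.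
pose r := [:: a; b; c]; pose X n := generated [set` take n r].
have rT x : x \in r -> T x by rewrite !inE => /or3P[]/eqP->.
have runiq : uniq r.
  rewrite /r /= !inE !andbT negb_or; apply/andP; split.
    by apply/andP; split; apply/eqP => e; apply: abc; rewrite e;
      [exact: Or31|exact: Or32].
  by apply/eqP => e; apply: abc; rewrite e; exact: Or33.
have take_le i j : (i <= j)%N -> [set` take i r] `<=` [set` take j r].
  by move=> ij x /= xi; apply: (mem_take (n0 := i)); rewrite take_takel.
have Xle i j : (i <= j)%N -> X i `<=` X j.
  by move=> ij; apply: generated_sub; exact: take_le.
have XT i : spherical C [set` take i r].
  have sub : [set` take i r] `<=` T by move=> x /= /mem_take /rT.
  split; first exact: subset_trans TS.
  exact: sub_finite_set (generated_sub sub) Tfin.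
have Xlt i j : (i < j <= 3)%N -> X i <> X j.
  case/andP=> ij j3 Xij; have ir : (i < size r)%N by exact: leq_trans ij j3.
  have xr : nth 1 r i \in r by exact: mem_nth.
  have xS : nth 1 r i \in cox_gens C by exact/TS/rT.
  have : X i (val [` xS]%fset).
    rewrite Xij; apply: sub_generated => /=.
    by rewrite -(nth_take _ ij) mem_nth // size_takel.
  move/(generated_gen (XT i).1) => /=; rewrite in_take //.
  by rewrite index_uniq // ltnn.
have : davis_simplex C 3 [set X i | i in `I_4].
  split=> [_ [i _ <-]|_ _ [i _ <-] [j _ <-]|].
  - exists 1, [set` take i r]; split; first exact: XT.
    apply/seteqP; split=> [x Xx|_ [x Xx <-]]; last by rewrite mul1g.
    by exists x; rewrite ?mul1g.
  - by have [ij|/ltnW ji] := leqP i j; [left|right]; exact: Xle.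
  - apply: inj_card_eq => i j /set_mem/= i4 /set_mem/= j4 Xij.
    have [ij|ji|//] := ltngtP i j.
      by case: (@Xlt i j); rewrite // ij -ltnS.
    by case: (@Xlt j i); rewrite // ji -ltnS.
by move/dim2.
Qed.

End SphericalSubsets.

(** * Dihedral groups *)

Section Dihedral.
Variables (W : groupType) (s t : W).
Hypotheses (ss : s * s = 1) (tt : t * t = 1).

Let c := s * t.

Let sV : s^-1 = s. Proof. exact: mulg1_eq. Qed.

Let tV : t^-1 = t. Proof. exact: mulg1_eq. Qed.

Definition rotation : set W := [set a | exists k, a = c ^+ k \/ a = c ^- k].

Let cJs k : s * c ^+ k * s = c ^- k.
Proof.
have -> : c ^- k = (c ^+ k) ^ s.
  by rewrite conjXg conjgE /c sV !mulgA ss mul1g -expVgn invgM sV tV.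
by rewrite conjgE sV mulgA.
Qed.

Lemma rotation_subgroup : is_subgroup rotation.
Proof.
split=> [|a b [k ak] [l bl]|a [k ak]]; first by exists 0%N; left; rewrite expg0.
  have cc i j : rotation (c ^+ i / c ^+ j).
    have [le|/ltnW le] := leqP j i; first by exists (i - j)%N; left;
      rewrite expgnFr.
    by exists (j - i)%N; right; rewrite expgnFr // invgF.
  have com i j : commute (c ^+ i) (c ^- j).
    by apply/commuteV/commuteX2; exact: commute_refl.
  case: ak => ->; case: bl => ->; rewrite -?(com l k) //.
    by exists (k + l)%N; left; rewrite expgnDr.
  by exists (l + k)%N; right; rewrite expgnDr invgM.
by exists k; case: ak => ->; [right|left; rewrite invgK].
Qed.

Lemma rotationJ a : rotation a -> rotation (s * a * s).
Proof.
move=> [k [->|->]]; exists k; first by right; rewrite cJs.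
by left; rewrite -cJs !mulgA ss mul1g -mulgA ss mulg1.
Qed.

Lemma dihedral_rotation a :
  generated [set s; t] a -> rotation a \/ rotation (a * s).
Proof.
have [R1 RM RV] := rotation_subgroup.
apply: (@generated_min _ [set a | rotation a \/ rotation (a * s)]); last first.
  move=> _ [] ->; right; first by rewrite ss; exact: R1.
  by exists 1%N; right; rewrite expg1 /c invgM sV tV.
split=> [|x y|x].
- by left.
- case=> Rx [] Ry.
  + by left; exact: RM.
  + by right; rewrite -mulgA; exact: RM.
  + right; have := RM _ _ Rx (rotationJ Ry).
    by rewrite !mulgA -(mulgA x) ss mulg1.
  + left; have := RM _ _ Rx (rotationJ Ry).
    by rewrite !mulgA -(mulgA x) ss mulg1 -!mulgA ss mulg1.
- case=> Rx; first by left; exact: RV.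
  by right; have := rotationJ (RV _ Rx); rewrite invgM sV !mulgA ss mul1g.
Qed.

(** Conjugation by the inverse of [c] turns [c ^+ k * s] into [c ^+ k.+2 * s], so everything reduces
    to [s] and [s * t * s]. *)
Lemma rotation_reflection a :
  rotation (a * s) -> exists x, a = s ^ x \/ a = t ^ x.
Proof.
suff main k : exists x, c ^+ k * s = s ^ x \/ c ^+ k * s = t ^ x.
  move=> [k Rk]; have -> : a = a * s * s by rewrite -mulgA ss mulg1.
  case: Rk => ->; first exact: main.
  have [x e] := main k; exists (x * s); rewrite !conjgM.
  have -> : c ^- k * s = (c ^+ k * s) ^ s.
    by rewrite conjgE -cJs sV -!mulgA.
  by case: e => ->; [left|right].
elim/ltn_ind: k => -[|[|k]] IHk.
- by exists 1; left; rewrite expg0 mul1g conjg1.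
- by exists s; right; rewrite expg1 conjgE sV /c mulgA.
- have [x e] := IHk k (leqnSn _); exists (x * c^-1); rewrite !conjgM.
  have -> : c ^+ k.+2 * s = (c ^+ k * s) ^ c^-1.
    rewrite conjgE invgK {3}/c invgM sV tV expgS -addn1 expgnDr expg1 -!mulgA.
    by congr (_ * (_ * _)); rewrite /c -!mulgA.
  by case: e => ->; [left|right].
Qed.

(** [s] inverts every rotation, hence commutes with one that is its own inverse; rotations commute
    with [c]. *)
Lemma rotation_involution_central a b : rotation a -> a * a = 1 ->
  generated [set s; t] b -> commute a b.
Proof.
move=> Ra aa; have aV : a^-1 = a by exact: mulg1_eq.
apply: (@generated_min _ [set b | commute a b]).
  split=> [|x y|x]; [exact: commute1|exact: commuteM|exact: commuteV].
have as_ : commute a s.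
  have : s * a * s = a.
    rewrite -[RHS]aV; case: Ra => k [->|->]; first exact: cJs.
    by rewrite -cJs invgM invgM sV -cJs -!mulgA ss !mulgA ss mulg1 mul1g.
  by move=> e; rewrite /commute -{1}e -!mulgA ss mulg1.
have ac : commute a c.
  by case: Ra => k [->|->]; apply: commute_sym; [|apply: commuteV];
    apply: commuteX; exact: commute_refl.
move=> _ [] -> //; rewrite (_ : t = s * c); first exact: commuteM.
by rewrite /c mulgA ss mul1g.
Qed.

(** Subtractive Euclid on exponents: for involutions [c ^+ i] and [c ^+ j] with [i <= j], the
    product is [c ^+ (j - i)]. Either it is trivial and they are equal, or it is an involution to
    which induction applies, forcing [c ^+ j = 1]. *)
Lemma rotation_involution_unique a b : rotation a -> rotation b ->
  a * a = 1 -> b * b = 1 -> a <> 1 -> b <> 1 -> a = b.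
Proof.
have pos x : rotation x -> x * x = 1 -> exists k, x = c ^+ k.
  move=> [k [->|xk]] xx; exists k => //.
  by rewrite -[c ^+ k]invgK -xk; apply/esym/mulg1_eq.
move=> Ra Rb aa bb; have [i ai] := pos _ Ra aa; have [j bj] := pos _ Rb bb.
rewrite {}ai {}bj {Ra Rb pos a b} in aa bb *.
have [n] := ubnP (i + j)%N; elim: n i j aa bb => // n IHn i j aa bb le ai bj.
wlog ij : i j aa bb le ai bj / (i <= j)%N.
  move=> wl; have [ij|/ltnW ji] := leqP i j; first by apply: wl.
  by apply/esym/wl => //; rewrite addnC.
case: i aa le ai ij => [|i] aa le ai ij; first by rewrite expg0 in ai.
have e : c ^+ (j - i.+1) = c ^+ j * c ^+ i.+1.
  by rewrite expgnFr // -[in RHS](mulg1_eq aa).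
have com : commute (c ^+ j) (c ^+ i.+1).
  by apply: commuteX2; exact: commute_refl.
have [d1|d1] := EM (c ^+ (j - i.+1) = 1).
  by apply: (@mulIg _ (c ^+ i.+1)); rewrite aa -e d1.
have : c ^+ i.+1 = c ^+ (j - i.+1).
  apply: IHn => //; last by lia.
  by rewrite e {2}com -mulgA (mulgA (c ^+ i.+1)) aa mul1g.
rewrite e -[LHS]mul1g => /mulIg /esym /bj [].
Qed.

Lemma finite_dihedral n : (0 < n)%N -> c ^+ n = 1 ->
  finite_set (generated [set s; t]).
Proof.
move=> n0 cn.
have powE k : c ^+ k = c ^+ (k %% n).
  by rewrite {1}(divn_eq k n) expgnDr mulnC expgnA cn expg1n mul1g.
have finR : finite_set rotation.
  apply: (@sub_finite_set _ _ ([set c ^+ k | k in `I_n] `|` [set c ^- k | k in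
    `I_n])).
    move=> a [k [->|->]]; [left|right]; exists (k %% n)%N => //;
      by [exact: ltn_pmod|rewrite -powE].
  by rewrite finite_setU; split; apply: finite_image; exact: finite_II.
apply: (@sub_finite_set _ _ (rotation `|` [set a * s | a in rotation])).
  move=> a /dihedral_rotation[Ra|Ra]; [by left|right; exists (a * s) => //].
  by rewrite -mulgA ss mulg1.
by rewrite finite_setU; split=> //; exact: finite_image.
Qed.

End Dihedral.

Lemma finite_order (W : groupType) (H : set W) x : is_subgroup H ->
  finite_set H -> H x -> exists2 n, (0 < n)%N & x ^+ n = 1.
Proof.
move=> HH Hfin Hx; apply: contrapT => none.
have inj : injective (fun n => x ^+ n).
  move=> i j /= e; wlog ij : i j e / (i <= j)%N.
    by move=> wl; have [|/ltnW] := leqP i j; [exact: wl|move/wl->].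
  move: ij; rewrite leq_eqVlt => /orP[/eqP//|ij]; case: none.
  exists (j - i)%N; first by rewrite subn_gt0.
  by rewrite expgnFr ?(ltnW ij) // e mulgV.
apply: infinite_nat; have <- : (fun n => x ^+ n) @^-1` H = setT.
  by apply/seteqP; split=> // n _; exact: subgroupX.
by apply: finite_preimage => //; exact: in2W.
Qed.

(** * Reflections *)

Section Reflections.
Variables (W : groupType) (C : coxeterSystem W).

Notation I := (cox_gens C).

Lemma reflections_gen (s : I) : reflections C (val s).
Proof. by exists (val s), 1; split; [exact: valP|rewrite conjg1]. Qed.

Lemma reflectionsJ a x : reflections C a -> reflections C (a ^ x).
Proof. by move=> [s [w [sC ->]]]; exists s, (w * x); rewrite conjgM. Qed.

Lemma reflections_conj a : reflections C a -> exists (s : I) w, a = val s ^ w.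
Proof. by move=> [s [w [sC ->]]]; exists [` sC]%fset, w. Qed.

Lemma par_reflection a : reflections C a -> par C a.
Proof. by move=> /reflections_conj[s [w ->]]; rewrite parJ par_gen. Qed.

Lemma par_rotation (s t : I) a : rotation (val s) (val t) a -> par C a = false.
Proof.
suff parX k : par C ((val s * val t) ^+ k) = false.
  by case=> k [->|->]; rewrite ?parV.
by elim: k => [|k IHk]; rewrite ?expg0 ?par1 // expgS !par_morph !par_gen IHk.
Qed.

(** Parity separates the two halves of a dihedral group, since every rotation has even length. *)
Lemma dihedral_odd (s t : I) a : generated [set val s; val t] a -> par C a ->
  exists x, a = val s ^ x \/ a = val t ^ x.
Proof.
move=> Ga pa.
case: (dihedral_rotation (gen_sqr s) (gen_sqr t) Ga) => [/par_rotation|Ra].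
  by rewrite pa.
by apply: rotation_reflection Ra; exact: gen_sqr.
Qed.

Lemma dihedral_even (s t : I) a : generated [set val s; val t] a ->
  par C a = false -> rotation (val s) (val t) a.
Proof.
move=> Ga pa; case: (dihedral_rotation (gen_sqr s) (gen_sqr t) Ga) => //.
by move/par_rotation; rewrite par_morph pa par_gen.
Qed.

(** [phi] pairs a vector with the root of [p], and [gamma] spans the (-1)-eigenline. *)
Lemma rep_reflection p : reflections C p ->
  exists (phi : (I -> R) -> R) (gamma : I -> R),
    (forall y, rep p y = fun t => phi y * gamma t + y t)%Re /\
    rep p gamma = (fun t => -1 * gamma t)%Re.
Proof.
move=> /reflections_conj[s [w ->]].
have refE z : refl s z = (fun t => z s * cartan s t + z t)%Re.
  by apply/funext => t; rewrite /refl; ring.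
exists (fun y => rep w y s), (rep w^-1 (cartan s)); split=> [y|].
  by rewrite conjgE !repM rep_gen refE rep_linear repK.
rewrite conjgE !repM repVK rep_gen -repZ; congr rep.
by apply/funext => t; rewrite /refl cartan_diag; ring.
Qed.

Lemma reflection_sqr p : reflections C p -> p * p = 1.
Proof. by move=> /reflections_conj[s [w ->]]; rewrite -conjMg gen_sqr conj1g.
  Qed.

(* Otherwise p and q move v in the same direction, hence have the same
   (-1)-eigenline, and two commuting reflections with the same (-1)-eigenline
   are equal. *)
Lemma commuting_reflections_fix p q (v : I -> R) :
  reflections C p -> reflections C q -> commute p q -> p <> q ->
  stab v (p * q) -> stab v p.
Proof.
move=> Rp Rq pq_com neq; rewrite /stab /= => pqv.
have eqv : rep p v = rep q v by rewrite -{1}pqv -repM mulgA (reflection_sqr Rp)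
  mul1g.
have [phi [g [pE pg]]] := rep_reflection Rp.
have [psi [h [qE qh]]] := rep_reflection Rq.
have [phi0|phi0] := EM (phi v = 0%Re).
  by rewrite pE phi0; apply/funext => t; ring.
pose e := (psi v / phi v)%Re.
have gE t : g t = (e * h t)%Re.
  have := congr1 (fun y => y t) eqv; rewrite pE qE => ev.
  suff : (phi v * g t = phi v * (e * h t))%Re by move/Rmult_eq_reg_l; exact.
  have -> : (phi v * (e * h t) = psi v * h t)%Re by rewrite /e; field.
  by lra.
have [e0|e0] := EM (e = 0%Re).
  by rewrite pE; apply/funext => t; rewrite gE e0; ring.
have ph : rep p h = (fun t => -1 * h t)%Re.
  have gh : g = (fun t => e * h t)%Re by apply/funext.
  move: pg; rewrite gh repZ => /(congr1 (fun y t => / e * y t)%Re) ph.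
  apply/funext => t; have := congr1 (fun y => y t) ph => /= pht.
  have -> : rep p h t = (/ e * (e * rep p h t))%Re by field.
  by rewrite pht; field.
(* The products [p * q] and [q * p] move [y] along [h] by opposite amounts, so commuting forces
   [p * q = 1]. *)
case: neq; apply: (@mulIg _ q); rewrite (reflection_sqr Rq).
apply: (@rep_faithful W C); apply/funext => y; apply/funext => t.
have pE' z : rep p z = (fun t => phi z * e * h t + z t)%Re.
  by rewrite pE; apply/funext => u; rewrite gE; ring.
have := congr1 (fun w => rep w y t) pq_com.
rewrite /= !repM qE rep_linear ph pE' (rep_linear q (phi y * e)) qh qE /=.
lra.
Qed.

End Reflections.

(** * Generators that are not reflections of the other system *)

Section Involutions.
Variables (W : groupType) (C : coxeterSystem W).

Notation I := (cox_gens C).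

Hypothesis smallC : small_spherical C.

(** A singleton is the case [s = t], a degenerate dihedral group. *)
Lemma spherical_pair (T : set W) : spherical C T ->
  T = set0 \/ exists s t : I, [/\ T (val s), T (val t) & T `<=` [set val s;
    val t]].
Proof.
move=> sT; have [TS _] := sT.
have [->|/set0P[a Ta]] := eqVneq T set0; [by left|right].
have gen c : T c -> exists s : I, c = val s by move=> /TS cS;
  exists [` cS]%fset.
have [s sE] := gen a Ta; have [[b Tb ba]|none] := EM (exists2 b, T b & b <> a).
  have [t tE] := gen b Tb; exists s, t; rewrite -sE -tE; split=> // c Tc.
  by case: (smallC sT Ta Tb Tc) => [ab|<-|<-]; [case: ba|left|right].
exists s, s; rewrite -sE; split=> // c Tc; left; apply: contrapT => ca.
by apply: none; exists c.
Qed.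

Lemma generated_set0 : generated (set0 : set W) = [set 1].
Proof.
apply/seteqP; split; last by move=> _ ->;
  case: (generated_subgroup (set0 : set W)).
apply: generated_min => //; split=> [//|x y -> ->|x ->]; first by rewrite mul1g.
by rewrite invg1.
Qed.

Lemma generated_involution (s : W) : s * s = 1 ->
  generated [set s] = [set 1; s].
Proof.
move=> ss; apply/seteqP; split.
  apply: generated_min => [|_ ->]; last by right.
  split=> [|x y|x]; first by left.
    by move=> [] -> [] ->; rewrite ?mul1g ?mulg1 ?ss; [left|right|right|left].
  by move=> [] ->; [left; rewrite invg1|right; exact: mulg1_eq].
by move=> _ [] ->; [case: (generated_subgroup [set s])|exact: sub_generated].
Qed.

Lemma finite_generated_involution (s : W) : s * s = 1 ->
  finite_set (generated [set s]).
Proof. by move=> /generated_involution->; rewrite finite_setU; split;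
  exact: finite_set1. Qed.

Lemma finite_subgroup_pair (H : set W) (r : W) :
  is_subgroup H -> finite_set H -> H r -> r <> 1 ->
  exists (v : I -> R) (x : W) (s t : I), [/\ H `<=` stab v,
    finite_set (stab v),
    forall a, stab v a -> generated [set val s; val t] (a ^ x),
    stab v (val s ^ x^-1) & stab v (val t ^ x^-1)].
Proof.
move=> HH Hfin Hr r1; have [v [Hv vfin [x [T [sT vT]]]]] :=
  finite_subgroup_stab C HH Hfin.
have [T0|[s [t [Ts Tt Tst]]]] := spherical_pair sT.
  have /vT := Hv _ Hr; rewrite T0 generated_set0 => /eqP.
  by rewrite conjg_eq1 => /eqP.
exists v, x, s, t; split=> //.
- by move=> a /vT; exact: generated_sub.
- by apply/vT; rewrite conjgKV; exact: sub_generated.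
- by apply/vT; rewrite conjgKV; exact: sub_generated.
Qed.

(** The stabilizer is dihedral up to conjugation, and its odd elements are reflections. So [r] is an
    even involution, that is, a half-turn: it is central, and any other involution must be odd. *)
Lemma nonreflection_stab (H : set W) r : is_subgroup H -> finite_set H ->
  H r -> r * r = 1 -> r <> 1 -> ~ reflections C r ->
  par C r = false /\ exists v : I -> R,
    [/\ H `<=` stab v, finite_set (stab v),
      forall a, stab v a -> commute r a /\ (par C a -> reflections C a),
      forall a, stab v a -> a * a = 1 -> a <> 1 -> a <> r -> par C a &
      exists2 a, stab v a & par C a].
Proof.
move=> HH Hfin Hr rr r1 nRr.
have [v [x [s [t [Hv vfin vD vs vt]]]]] := finite_subgroup_pair HH Hfin Hr r1.
have odd_refl a : stab v a -> par C a -> reflections C a.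
  move=> /vD Da; rewrite -(parJ C a x) => /(dihedral_odd Da)[y e].
  rewrite -(conjgK x a); apply: reflectionsJ.
  by case: e => ->; apply: reflectionsJ; exact: reflections_gen.
have vr := Hv _ Hr; have pr : par C r = false.
  by apply/negP => /(odd_refl _ vr).
have rot a : stab v a -> par C a = false -> rotation (val s) (val t) (a ^ x).
  by move=> /vD Da pa; apply: dihedral_even => //; rewrite parJ.
have sqrJ a : a * a = 1 -> a ^ x * a ^ x = 1 by rewrite -conjMg => ->;
  rewrite conj1g.
have oneJ a : a <> 1 -> a ^ x <> 1 by move=> a1 /eqP; rewrite conjg_eq1 => /eqP.
split=> //; exists v; split=> // [a va|a va aa a1 ar|].
- split; last exact: odd_refl.
  apply: (@conjg_inj _ x); rewrite !conjMg.
  apply: (rotation_involution_central (gen_sqr s) (gen_sqr t)) (vD _ va).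
    exact: rot.
  exact: sqrJ.
- apply: contrapT => /negP/negbTE pa; apply: ar; apply: (@conjg_inj _ x).
  apply: (rotation_involution_unique (s := val s) (t := val t));
    by [exact: rot|exact: sqrJ|exact: oneJ].
- by exists (val s ^ x^-1); rewrite // parJ par_gen.
Qed.

End Involutions.

(** * Neighbours of a generator that is not a reflection *)

Section BadGenerators.
Variables (W : groupType) (C C' : coxeterSystem W).
Hypotheses (smallC : small_spherical C) (smallC' : small_spherical C').

Notation I := (cox_gens C).
Notation bad s := (~ reflections C' (val s)).

Lemma gen_neq1P (s : I) : val s <> 1.
Proof. exact/eqP/gen_neq1. Qed.

Lemma val_neq (s t : I) : s != t -> val s <> val t.
Proof. by move=> /eqP st /val_inj. Qed.

Lemma finite_rank2 (s u : I) n : cox_ord s u = Some n ->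
  finite_set (generated [set val s; val u]).
Proof.
move=> msu; apply: (@finite_dihedral _ _ _ (gen_sqr s) (gen_sqr u) n).
  have [su|su] := eqVneq s u; last exact: ltnW (cox_ord_ge2 su msu).
  by move: msu; rewrite su cox_ord_diag => -[<-].
exact: gen_rel.
Qed.

(** A [C']-stabilizer containing [s] and [u] has [s] as central half-turn, so [u] commutes with [s],
    and [u] and [s * u] are odd. *)
Lemma bad_neighbour (s u : I) n : bad s -> u != s -> cox_ord s u = Some n ->
  [/\ n = 2%N, reflections C' (val u) & reflections C' (val s * val u)].
Proof.
move=> bs us msu; pose H := generated [set val s; val u].
have Hs : H (val s) by apply: sub_generated; left.
have Hu : H (val u) by apply: sub_generated; right.
have [ps [v [Hv _ vP vinv _]]] := nonreflection_stab smallC'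
  (generated_subgroup _) (finite_rank2 msu) Hs (gen_sqr s) (@gen_neq1P s) bs.
have [com _] := vP _ (Hv _ Hu).
have pu : par C' (val u).
  apply: vinv; [exact: Hv|exact: gen_sqr|exact: gen_neq1P|exact: val_neq].
split; first by apply: commute_order2 msu com; rewrite eq_sym.
  by apply: (vP _ (Hv _ Hu)).2.
have [_ HM _] := generated_subgroup [set val s; val u].
by apply: (vP _ (Hv _ (HM _ _ Hs Hu))).2; rewrite par_morph ps pu.
Qed.

(** [u2] and [s * u2] are commuting reflections of [C'] with product [s], so [u2] fixes every point
    fixed by [s]. Then [s], [u1], [u2] lie in one finite stabilizer, and [smallC] leaves only
    [u1 = u2]. *)
Lemma bad_neighbour_unique (s u1 u2 : I) : bad s -> u1 != s -> u2 != s ->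
  cox_ord s u1 <> None -> cox_ord s u2 <> None -> u1 = u2.
Proof.
move=> bs us1 us2.
case m1: (cox_ord s u1) => [n1|] // _; case m2: (cox_ord s u2) => [n2|] // _.
have [n12 _ _] := bad_neighbour bs us1 m1.
have [n22 Ru2 Rsu2] := bad_neighbour bs us2 m2.
pose H := generated [set val s; val u1].
have Hs : H (val s) by apply: sub_generated; left.
have Hu1 : H (val u1) by apply: sub_generated; right.
have [ps [v [Hv vfin vP _ _]]] := nonreflection_stab smallC'
  (generated_subgroup _) (finite_rank2 m1) Hs (gen_sqr s) (@gen_neq1P s) bs.
have com : commute (val u2) (val s).
  rewrite n22 in m2; have := gen_rel m2; rewrite expg2 -mulgA.
  move/mulg1_eq; rewrite genV => e; rewrite /commute {2}e.
  by rewrite -!mulgA gen_sqr mulg1.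
have vu2 : stab v (val u2).
  apply: (@commuting_reflections_fix _ _ _ (val s * val u2)) => //.
  - by rewrite /commute mulgA com -!mulgA.
  - by move=> e; apply: (@gen_neq1P s); apply: (@mulIg _ (val u2));
    rewrite mul1g.
  - by rewrite mulgA com -mulgA gen_sqr mulg1; exact: Hv.
have fin3 : spherical C [set val s; val u1; val u2]%classic.
  split; first by move=> _ [[]|] ->; exact: valP.
  apply: sub_finite_set vfin; apply: generated_min (stab_subgroup v) _.
  by move=> _ [[]|] -> //; exact: Hv.
have [] := smallC fin3 (or_introl (or_introl (erefl (val s))))
  (or_introl (or_intror (erefl (val u1)))) (or_intror (erefl (val u2))).
- by move/val_inj => e; rewrite e eqxx in us1.
- by move/val_inj => e; rewrite e eqxx in us2.
- exact: val_inj.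
Qed.

(** A finite stabilizer for [C'] contains [s] and an element [a] odd for [C']; being finite, it lies
    in a finite dihedral stabilizer for [C]. If [s] had no finite order with another generator, the
    latter would be conjugate to the group of order two generated by [s], leaving no room for [a],
    or to an infinite dihedral group. *)
Lemma bad_neighbour_exists (s : I) : bad s ->
  exists2 u, u != s & cox_ord s u <> None.
Proof.
move=> bs; apply: contrapT => none.
have inf u : u != s -> cox_ord s u = None.
  by move=> us; apply: contrapT => m; apply: none; exists u.
have [psE [v [Hv vfin vP _ [a va pa]]]] := nonreflection_stab smallC'
  (generated_subgroup [set val s]) (finite_generated_involution (gen_sqr s))
  (sub_generated (erefl : [set val s] (val s))) (gen_sqr s) (@gen_neq1P s) bs.
have vs : stab v (val s) by apply: Hv; apply: sub_generated.
have [v2 [x [p [q [v2v v2fin v2D v2p v2q]]]]] :=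
  finite_subgroup_pair smallC (stab_subgroup v) vfin vs (@gen_neq1P s).
(* [chi] counts occurrences of [s] modulo 2; being constant on conjugacy classes, it identifies [s]
   as one of [p], [q]. *)
have [|chi [chiM chiE]] := @lift_bool W C (eq_op^~ s).
  move=> s1 t1 n m _; have [-> //|s1t1] := eqVneq s1 t1.
  have [s1s|_] := eqVneq s1 s.
    by move: m; rewrite s1s inf // -s1s eq_sym.
  have [t1s|//] := eqVneq t1 s.
  by move: m; rewrite cox_ordC t1s inf // -t1s.
have chiJ a1 w : chi (a1 ^ w) = chi a1.
  have chi1 : chi 1 = false by have := chiM 1 1; rewrite mulg1; case: (chi 1).
  have chiV : chi w^-1 = chi w.
    by have := chiM w^-1 w; rewrite mulVg chi1; case: (chi _) (chi _) => [] [].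
  by rewrite conjgE !chiM chiV addbCA addbb addbF.
have chis : chi (val s) by rewrite chiE eqxx.
wlog ps : p q v2D v2p v2q / p = s.
  move=> wl; have [y e] : exists y,
    val s ^ x = val p ^ y \/ val s ^ x = val q ^ y.
    by apply: dihedral_odd (v2D _ (v2v _ vs)) _; rewrite parJ par_gen.
  have : p = s \/ q = s.
    by case: e => /(congr1 chi); rewrite !chiJ chis chiE => /esym/eqP;
      [left|right].
  case=> [|qs]; first by move=> ps; apply: (wl p q).
  by apply: (wl q p) => // b /v2D; rewrite setUC.
have [qs|qs] := eqVneq q s.
  have Hx b : stab v b -> b ^ x = 1 \/ b ^ x = val s.
    move=> /v2v/v2D; rewrite ps qs setUid generated_involution //.
    exact: gen_sqr.
  case: (Hx _ va) => [/eqP|ax].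
    by rewrite conjg_eq1 => /eqP a1; move: pa; rewrite a1 par1.
  case: (Hx _ vs) => [/eqP|sx]; first by rewrite conjg_eq1 (negPf (gen_neq1 s)).
  have as_ : a = val s by apply: (@conjg_inj _ x); rewrite ax sx.
  by rewrite as_ psE in pa.
have [_ vM _] := stab_subgroup v2.
have [n n0] := finite_order (stab_subgroup v2) v2fin (vM _ _ v2p v2q).
rewrite -conjMg -conjXg => /eqP; rewrite conjg_eq1 => /eqP.
rewrite ps; move/(infinite_order); rewrite eq_sym => /(_ qs (inf _ qs)) nE.
by rewrite nE in n0.
Qed.

End BadGenerators.

(** * The modified system *)

Section Transport.
Variables (W : groupType) (C : coxeterSystem W) (phi : W -> W).
Hypotheses (phiM : {morph phi : x y / x * y}) (phiK : involutive phi).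

(** The presentation is carried over letter by letter along [phi], which serves as its own
    inverse. *)
Lemma involution_system : exists C' : coxeterSystem W, cox_isomorphic C' C /\
  forall x, (x \in cox_gens C') = (phi x \in cox_gens C).
Proof.
pose S := [fset phi x | x in cox_gens C]%fset.
have SE x : (x \in S) = (phi x \in cox_gens C).
  apply/imfsetP/idP => [[y yC ->]|xC]; first by rewrite phiK.
  by exists (phi x); rewrite ?phiK.
have toP (s : S) : phi (val s) \in cox_gens C by rewrite -SE; exact: valP.
have ofP (t : cox_gens C) : phi (val t) \in S by rewrite SE phiK; exact: valP.
pose to (s : S) : cox_gens C := [` toP s]%fset.
pose of_ (t : cox_gens C) : S := [` ofP t]%fset.
have toK : cancel to of_ by move=> s; apply: val_inj; rewrite /= phiK.
have ofK : cancel of_ to by move=> s; apply: val_inj; rewrite /= phiK.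
pose ord s t := cox_ord (to s) (to t).
have ordC s t : ord s t = ord t s by exact: cox_ordC.
have ord_diag s : ord s s = Some 1%N by exact: cox_ord_diag.
have ord_ge2 s t n : s != t -> ord s t = Some n -> (2 <= n)%N.
  by move=> st; apply: cox_ord_ge2; rewrite (can_eq toK).
have phi1 : phi 1 = 1 by exact: morphism1.
have evE (u : word S) : eval_word (fun s : S => val s) u =
    phi (eval_word (fun s : cox_gens C => val s) [seq (to l.1, l.2) | l <- u]).
  rewrite /eval_word; elim: u => [|[s b] u IHu]; first by rewrite !big_nil phi1.
  rewrite /= !big_cons phiM IHu /=; case: b => /=; rewrite ?phiK //.
  congr (_ * _); apply: mulg1_eq.
  by rewrite -[X in X * _]phiK -phiM mulgV phi1.
have mapK (u : word S) :
    [seq (of_ l.1, l.2) | l <- [seq (to l.1, l.2) | l <- u]] = u.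
  by rewrite -map_comp -[RHS]map_id; apply: eq_map => -[s b] /=; rewrite toK.
have mapVK (u : word (cox_gens C)) :
    [seq (to l.1, l.2) | l <- [seq (of_ l.1, l.2) | l <- u]] = u.
  by rewrite -map_comp -[RHS]map_id; apply: eq_map => -[s b] /=; rewrite ofK.
have [surjC eqC] := cox_presents C.
have pres : presents (fun s : S => val s) (coxeter_relators ord).
  split=> [w|u v].
    have [u uw] := surjC (phi w); exists [seq (of_ l.1, l.2) | l <- u].
    by rewrite evE mapVK uw phiK.
  rewrite !evE; split=> [/(can_inj phiK)/eqC|] uv.
    rewrite -(mapK u) -(mapK v); apply: pres_eq_map uv.
    move=> _ [s [t [n [mst ->]]]]; exists (of_ s), (of_ t), n.
    by rewrite /ord !ofK; split=> //; elim: (n) => //= k ->.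
  congr phi; apply/eqC; apply: pres_eq_map uv.
  move=> _ [s [t [n [mst ->]]]]; exists (to s), (to t), n.
  by split=> //; elim: (n) => //= k ->.
exists (CoxeterSystem ordC ord_diag ord_ge2 pres); split=> //.
by exists to => //; exists of_.
Qed.

Lemma small_spherical_involution (C' : coxeterSystem W) :
  (forall x, (x \in cox_gens C') = (phi x \in cox_gens C)) ->
  small_spherical C -> small_spherical C'.
Proof.
move=> C'E small T a b c [TS Tfin] Ta Tb Tc.
have sT : spherical C [set phi x | x in T].
  split; first by move=> _ [x /TS xC <-] /=; rewrite -C'E.
  apply: sub_finite_set (finite_image phi Tfin).
  have [G1 GM GV] := generated_subgroup T.
  apply: generated_min => [|_ [x Tx <-]]; last first.
    by exists x => //; exact: sub_generated.
  have phi1 : phi 1 = 1 by exact: morphism1.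
  split=> [|_ _ [x Gx <-] [y Gy <-]|_ [x Gx <-]].
  - by exists 1.
  - by exists (x * y); [exact: GM|rewrite phiM].
  - exists x^-1; first exact: GV.
    by apply/esym/mulg1_eq; rewrite -phiM mulgV.
have im x : T x -> [set phi x | x in T] (phi x) by exists x.
by case: (small _ _ _ _ sT (im _ Ta) (im _ Tb) (im _ Tc)) => /(can_inj phiK);
  [exact: Or31|exact: Or32|exact: Or33].
Qed.

End Transport.

(** * Comparison of reflections and construction of the new system *)

Lemma reflections_eq (W : groupType) (C C' : coxeterSystem W) :
  small_spherical C -> (forall s : cox_gens C, reflections C' (val s)) ->
  reflections C = reflections C'.
Proof.
move=> smallC CC'.
have par_eq w : par C w = par C' w.
  elim/(@gen_ind W C): w => [|s w IHw]; first by rewrite !par1.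
  by rewrite !par_morph IHw par_gen (par_reflection (CC' s)).
apply/seteqP; split=> _ /reflections_conj[s [w ->]]; apply: reflectionsJ => //.
have [v [x [p [q [Hv _ vD _ _]]]]] := finite_subgroup_pair smallC
  (generated_subgroup [set val s]) (finite_generated_involution (gen_sqr s))
  (sub_generated (erefl : [set val s] (val s))) (@gen_neq1P _ _ s).
have vs : stab v (val s) by apply: Hv; exact: sub_generated.
have [|y e] := dihedral_odd (vD _ vs).
  by rewrite parJ par_eq par_gen.
rewrite -(conjgK x (val s)); apply: reflectionsJ.
by case: e => ->; apply: reflectionsJ; exact: reflections_gen.
Qed.

Theorem theorem2 (W : groupType) (C C' : coxeterSystem W)
    (hdim : davis_dim_eq C 2) (hdim' : davis_dim_eq C' 2) :
  exists C'' : coxeterSystem W,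
    cox_isomorphic C'' C /\ reflections C'' = reflections C'.
Proof.
have smallC := davis_small_spherical hdim.
have smallC' := davis_small_spherical hdim'.
(* [p s] is the unique partner of a bad [s]; a good [s] gets itself as a dummy value. *)
have /choice[p pP] (s : cox_gens C) : exists u, ~ reflections C' (val s) ->
    [/\ u != s, cox_ord s u = Some 2%N, reflections C' (val u),
      reflections C' (val s * val u) &
      forall t n, t != s -> cox_ord s t = Some n -> t = u].
  have [Rs|bs] := EM (reflections C' (val s)); first by exists s.
  have [u us] := bad_neighbour_exists smallC smallC' bs.
  case msu: (cox_ord s u) => [n|] // _; exists u => _.
  have [n2 Ru Rsu] := bad_neighbour smallC' bs us msu.
  split=> //; first by rewrite msu n2.
  move=> u' n' us' msu'; apply: (bad_neighbour_unique smallC smallC' bs) => //.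
    by rewrite msu'.
  by rewrite msu.
pose f (s : cox_gens C) : W :=
  if `[< reflections C' (val s) >] then val s else val s * val (p s).
have f_good (s : cox_gens C) : reflections C' (val s) -> f s = val s.
  by rewrite /f => /asboolP->.
have f_bad (s : cox_gens C) : ~ reflections C' (val s) ->
  f s = val s * val (p s).
  by rewrite /f => /asboolPn/negbTE->.
have f_refl s : reflections C' (f s).
  have [Rs|bs] := EM (reflections C' (val s)); first by rewrite f_good.
  by rewrite f_bad //; case: (pP s bs).
(* The only finite-order neighbour of a bad [s] is its partner, which is good and hence unchanged by
   [f]. *)
have f_nbr s t n : s != t -> ~ reflections C' (val s) ->
    cox_ord s t = Some n -> n = 2%N /\ f s * f t = val s.
  move=> st bs mst; have [_ msp Rp _ /(_ t n)] := pP s bs.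
  rewrite eq_sym => /(_ st mst) tp; move: mst; rewrite tp msp => -[<-];
    split=> //.
  by rewrite f_bad // f_good // -mulgA gen_sqr mulg1.
have [|phi [phiM phiE]] := lift_morphism (f := f).
  move=> s t n mst; have [st|st] := eqVneq s t.
    move: mst; rewrite st cox_ord_diag => -[<-]; rewrite expg1.
    exact: reflection_sqr (f_refl t).
  have [Rs|bs] := EM (reflections C' (val s)); last first.
    by have [-> ->] := f_nbr _ _ _ st bs mst; rewrite expg2 gen_sqr.
  have [Rt|bt] := EM (reflections C' (val t)).
    by rewrite !f_good //; exact: gen_rel.
  (* [f_nbr] takes the bad generator first; the product in the other order is the inverse. *)
  rewrite cox_ordC in mst; have ts : t != s by rewrite eq_sym.
  have [-> e] := f_nbr _ _ _ ts bt mst.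
  have -> : f s * f t = (f t * f s)^-1.
    by rewrite invgM !(mulg1_eq (reflection_sqr (f_refl _))).
  by rewrite e genV expg2 gen_sqr.
have phiK : involutive phi.
  apply: (@morph_gen_eq _ C _ (phi \o phi) id) => [x y|//|s] /=.
    by rewrite !phiM.
  rewrite phiE; have [Rs|bs] := EM (reflections C' (val s)).
    by rewrite !f_good // phiE f_good.
  have [ps msp _ _ _] := pP s bs.
  (* A bad [s] goes to [s * p s], which returns as [f s * f (p s) = s]. *)
  rewrite f_bad // phiM !phiE; apply: (f_nbr _ _ _ _ bs msp).2.
  by rewrite eq_sym.
have [C'' [isoC C''E]] := involution_system C phiM phiK.
exists C''; split=> //; apply: reflections_eq.
  exact: (@small_spherical_involution W C phi phiM phiK).
move=> s; have sC : phi (val s) \in cox_gens C by rewrite -C''E; exact: valP.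
by rewrite -(phiK (val s)) -[phi (val s)]/(val [` sC]%fset) phiE.
Qed.
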